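(* Let $A$ be a bijective skew $PBW$ extension of a ring $R$. If $R$ is a left regular and left Noetherian ring, then $A$ is left regular.
   Context: Rings are associative with identity, not necessarily commutative; $\mathbb{N}=\{0,1,2,\dots\}$. Let $R$ and $A$ be rings. $A$ is a skew $PBW$ extension of $R$, written $A=\sigma(R)\langle x_1,\dots,x_n\rangle$, if: (i) $R\subseteq A$; (ii) there are finitely many elements $x_1,\dots,x_n\in A$ such that $A$ is a free left $R$-module with basis $\mathrm{Mon}(A):=\{x^\alpha=x_1^{\alpha_1}\cdots x_n^{\alpha_n}\mid \alpha=(\alpha_1,\dots,\alpha_n)\in\mathbb{N}^n\}$ (with $x_1^0\cdots x_n^0:=1$); (iii) for every $1\le i\le n$ and $r\in R-\{0\}$ there exists $c_{i,r}\in R-\{0\}$ such that $x_ir-c_{i,r}x_i\in R$; (iv) for every $1\le i,j\le n$ there exists $c_{i,j}\in R-\{0\}$ such that $x_jx_i-c_{i,j}x_ix_j\in R+Rx_1+\cdots+Rx_n$. Then for every $i$ there are an injective ring endomorphism $\sigma_i:R\to R$ (with $\sigma_i(r)=c_{i,r}$ for $r\neq 0$) and a $\sigma_i$-derivation $\delta_i:R\to R$ such that $x_ir=\sigma_i(r)x_i+\delta_i(r)$ for all $r\in R$. $A$ is called bijective if $\sigma_i$ is bijective for every $1\le i\le n$ and $c_{i,j}$ is invertible for all $1\le i<j\le n$. A ring is left regular if every finitely generated left module over it has finite projective dimension. *)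

(* Defs.v *)
From HB Require Import structures.
From mathcomp Require Import all_boot all_order all_algebra.

Set Implicit Arguments.
Unset Strict Implicit.
Unset Printing Implicit Defensive.

Import GRing.Theory.
Local Open Scope ring_scope.

(* Rings are [pzRingType]s: associative with identity, not necessarily
   commutative, and 1 = 0 is not excluded. *)

Section Modules.
Variable R : pzRingType.

Definition finitely_generated (M : lmodType R) : Prop :=
  exists (k : nat) (e : 'I_k -> M),
    forall v : M, exists c : 'I_k -> R, v = \sum_(i < k) c i *: e i.

Definition surjective_map (U V : Type) (f : U -> V) : Prop :=
  forall v, exists u, f u = v.

Definition exact_at (U V W : lmodType R) (f : {linear U -> V})
    (g : {linear V -> W}) : Prop :=
  forall v : V, g v = 0 <-> exists u : U, f u = v.

Definition projective (P : lmodType R) : Prop :=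
  forall (M N : lmodType R) (g : {linear M -> N}) (f : {linear P -> N}),
    surjective_map g ->
    exists h : {linear P -> M}, forall p, g (h p) = f p.

Record projective_resolution (M : lmodType R) (P : nat -> lmodType R)
    (d : forall i, {linear P i.+1 -> P i}) (eps : {linear P 0 -> M}) : Prop :=
  ProjectiveResolution {
    resolution_projective : forall i, projective (P i);
    resolution_surjective : surjective_map eps;
    resolution_exact0 : exact_at (d 0) eps;
    resolution_exactS : forall i, exact_at (d i.+1) (d i)
  }.

Definition proj_dim_le (m : nat) (M : lmodType R) : Prop :=
  exists (P : nat -> lmodType R) (d : forall i, {linear P i.+1 -> P i})
         (eps : {linear P 0 -> M}),
    projective_resolution d eps
    /\ (forall i, (m < i)%N -> forall p : P i, p = 0).

Definition finite_proj_dim (M : lmodType R) : Prop :=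
  exists m, proj_dim_le m M.

Definition left_regular : Prop :=
  forall M : lmodType R, finitely_generated M -> finite_proj_dim M.

Record left_ideal (I : R -> Prop) : Prop := LeftIdeal {
  left_ideal0 : I 0;
  left_idealD : forall a b, I a -> I b -> I (a + b);
  left_idealM : forall r a, I a -> I (r * a)
}.

(* Ascending chain condition on left ideals. *)
Definition left_noetherian : Prop :=
  forall I : nat -> R -> Prop,
    (forall k, left_ideal (I k)) ->
    (forall k a, I k a -> I k.+1 a) ->
    exists N, forall k, (N <= k)%N -> forall a, I k a <-> I N a.

Definition invertible (c : R) : Prop := exists d, c * d = 1 /\ d * c = 1.

Definition skew_derivation (sigma : {rmorphism R -> R}) (delta : R -> R) : Prop :=
  (forall r s, delta (r + s) = delta r + delta s)
  /\ (forall r s, delta (r * s) = sigma r * delta s + delta r * s).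

End Modules.

Section SkewPBW.
(* The inclusion of R in A is an injective ring morphism [iota]; A is a left
   R-module through [iota r * a]. *)
Variables (R A : pzRingType) (iota : {rmorphism R -> A}).
Variables (n : nat) (x : 'I_n -> A).

(* The product is taken in increasing order of the index. *)
Definition monomial (alpha : {ffun 'I_n -> nat}) : A :=
  \prod_(i < n) x i ^+ alpha i.

Definition monomials_span : Prop :=
  forall a : A, exists (s : seq {ffun 'I_n -> nat}) (c : {ffun 'I_n -> nat} -> R),
    a = \sum_(alpha <- s) iota (c alpha) * monomial alpha.

Definition monomials_free : Prop :=
  forall (s : seq {ffun 'I_n -> nat}) (c : {ffun 'I_n -> nat} -> R),
    uniq s ->
    \sum_(alpha <- s) iota (c alpha) * monomial alpha = 0 ->
    forall alpha, alpha \in s -> c alpha = 0.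

(* x_j x_i - c x_i x_j lies in R + R x_1 + ... + R x_n. *)
Definition commutation_coef (i j : 'I_n) (c : R) : Prop :=
  exists (r0 : R) (r : 'I_n -> R),
    x j * x i - iota c * x i * x j = iota r0 + \sum_(k < n) iota (r k) * x k.

Record skew_PBW : Prop := SkewPBW {
  skew_PBW_sub : injective iota;
  skew_PBW_span : monomials_span;
  skew_PBW_free : monomials_free;
  skew_PBW_scalar : forall (i : 'I_n) (r : R), r <> 0 ->
    exists c : R, c <> 0 /\
      exists s : R, x i * iota r - iota c * x i = iota s;
  skew_PBW_var : forall i j : 'I_n,
    exists c : R, c <> 0 /\ commutation_coef i j c
}.

Definition twisting_pair (i : 'I_n) (sigma : {rmorphism R -> R})
    (delta : R -> R) : Prop :=
  [/\ injective sigma, skew_derivation sigma delta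
    & forall r, x i * iota r = iota (sigma r) * x i + iota (delta r)].

(* In a skew PBW extension the pair (sigma_i, delta_i) and, for i < j, the
   coefficient c_{i,j} are unique, because 1, the x_k and the x_i x_j with
   i < j are distinct basis monomials; hence the existential quantifiers. *)
Record bijective_skew_PBW : Prop := BijectiveSkewPBW {
  bijective_skew_PBW_base : skew_PBW;
  bijective_skew_PBW_sigma : forall i : 'I_n,
    exists (sigma : {rmorphism R -> R}) (delta : R -> R),
      twisting_pair i sigma delta /\ bijective sigma;
  bijective_skew_PBW_coef : forall i j : 'I_n, (i < j)%N ->
    exists c : R, commutation_coef i j c /\ invertible c
}.

End SkewPBW.

(* Main.v *)
(** Filter [A] by the degree in the [x_i].

    First, a finitely generated [A]-module [M] has finite projective dimension
    over [R].  Filter [M] by the monomials in degree-lexicographic order, which has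
    order type omega; the factors are [R / J] for left ideals [J] of leading
    coefficients.  Up to a twist by an automorphism of [R] these ideals increase
    with the exponent, so by Dickson's lemma and the ascending chain condition
    their projective dimensions are bounded, and Auslander's lemma bounds that
    of [M].

    Since free [A]-modules are [R]-free, it remains to treat an [A]-module [M] that
    is projective over [R]; if [K] is the kernel of a free [A]-cover of [M], then
    [M * K] is even free over [R].  An [R]-basis of an [A]-module is a system of
    generators without multiplicative variables, such that every [x_j] maps
    generators to combinations of standard terms of lower degree.  As for the Koszul
    complex (or a Pommaret basis of a polynomial module), the syzygies obtained by
    rewriting [x_j e_g], [j] non-multiplicative for [g], form a system of the same
    kind for the kernel of the cover, with [x_j, x_{j+1}, ...] as multiplicative
    variables.  At each step one more variable becomes multiplicative for all
    generators, so the [n]-th kernel is free.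
*)
Require Import Defs.
From HB Require Import structures.
From mathcomp Require Import all_boot all_order all_algebra.
From mathcomp Require Import boolp functions zify.

Set Implicit Arguments.
Unset Strict Implicit.
Unset Printing Implicit Defensive.

Import GRing.Theory.
Local Open Scope ring_scope.

(** * Submodules and free modules *)

Section LinearMaps.
Variable R : pzRingType.
Implicit Types U V W : lmodType R.

Definition mklin U V (f : U -> V) (lf : linear f) : {linear U -> V} :=
  HB.pack f (GRing.isLinear.Build R U V _ f lf).

Definition lincomp U V W (g : {linear V -> W}) (f : {linear U -> V}) :
  {linear U -> W} := [the {linear U -> W} of g \o f].

Definition linid U : {linear U -> U} := [the {linear U -> U} of idfun].

Definition linzero U V : {linear U -> V} := [the {linear U -> V} of \0].

Lemma lin_inv U V (f : {linear U -> V}) :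
  injective f -> surjective_map f ->
  exists g : {linear V -> U}, cancel f g /\ cancel g f.
Proof.
move=> f_inj /choice[g gK].
have lg : linear g.
  by move=> a u v; apply: f_inj; rewrite linearP !gK.
by exists (mklin lg); split=> u //=; apply: f_inj; rewrite gK.
Qed.

End LinearMaps.

Section Submodules.
Variables (R : pzRingType) (M : lmodType R).

(** The predicate is [Prop]-valued, because the submodules below are given by existential
    statements. [smem] decides it classically, so that [subm] inherits a module structure as a
    boolean subtype. *)
Record submod := Submod {
  sm_pred : M -> Prop;
  sm0 : sm_pred 0;
  smP : forall a u v, sm_pred u -> sm_pred v -> sm_pred (a *: u + v) }.

Variable S : submod.

Definition smem : {pred M} := fun v => `[< sm_pred S v >].

Lemma smem_closed : submod_closed smem.
Proof.
split; first by apply/asboolP/sm0.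
by move=> a u v /asboolP Su /asboolP Sv; apply/asboolP/smP.
Qed.

HB.instance Definition _ := GRing.isSubmodClosed.Build R M smem smem_closed.

Record subm := SubM { sval_m : M; _ : smem sval_m }.
HB.instance Definition _ := [isSub for sval_m].
HB.instance Definition _ := [Choice of subm by <:].
HB.instance Definition _ := [SubChoice_isSubLmodule of subm by <:].

Lemma subm_in (v : subm) : sm_pred S (val v).
Proof. by case: v => v /= /asboolP. Qed.

Definition mksubm v (Sv : sm_pred S v) : subm := SubM (asboolT Sv).

Definition subm_incl : {linear subm -> M} := [the {linear subm -> M} of val].

Lemma subm_incl_inj : injective subm_incl.
Proof. exact: val_inj. Qed.

Lemma corestrict_linear (U : lmodType R) (f : {linear U -> M}) (Sf : forall u,
  sm_pred S (f u)) :
  linear (fun u => mksubm (Sf u)).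
Proof. by move=> a u v; apply: val_inj; rewrite /= linearP. Qed.

Definition corestrict (U : lmodType R) (f : {linear U -> M}) Sf : {linear U -> subm} :=
  mklin (@corestrict_linear U f Sf).

End Submodules.

Section Kernel.
Variables (R : pzRingType) (M N : lmodType R) (f : {linear M -> N}).

Lemma ker_submodP a u v : f u = 0 -> f v = 0 -> f (a *: u + v) = 0.
Proof. by move=> fu fv; rewrite linearP fu fv scaler0 addr0. Qed.

Definition ker : submod M :=
  @Submod R M (fun v => f v = 0) (linear0 f) ker_submodP.

Lemma val_ker (v : subm ker) : f (val v) = 0.
Proof. exact: (subm_in v). Qed.

Lemma ker_exact : exact_at (subm_incl ker) f.
Proof.
move=> v; split=> [fv|[u <-]]; last exact: val_ker.
by exists (@mksubm _ _ ker _ fv).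
Qed.

End Kernel.

Section FreeModule.
Variables (R : pzRingType) (T : choiceType).

Definition finsupp (f : T -> R^o) := exists s : seq T, forall t, t \notin s -> f t = 0.

Lemma finsupp0 : finsupp 0.
Proof. by exists [::]. Qed.

Lemma finsuppP a u v : finsupp u -> finsupp v -> finsupp (a *: u + v).
Proof.
move=> [s hs] [s' hs']; exists (s ++ s') => t; rewrite mem_cat negb_or.
move=> /andP[/hs ut /hs' vt].
have -> : (a *: u + v) t = a *: u t + v t by [].
by rewrite ut vt scaler0 addr0.
Qed.

Definition fin_submod := Submod finsupp0 finsuppP.

Definition free_mod : lmodType R := subm fin_submod.

Definition coef (t : T) (f : free_mod) : R := val f t.

Lemma coef_linear t : linear (coef t : free_mod -> R^o).
Proof. by []. Qed.

HB.instance Definition _ t :=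
  GRing.isLinear.Build R free_mod R^o _ (coef t) (coef_linear t).

Definition lcoef t : {linear free_mod -> R^o} := [the {linear free_mod ->
  R^o} of coef t].

Lemma fcoefZD t a f g : coef t (a *: f + g) = a * coef t f + coef t g.
Proof. by []. Qed.

Lemma fcoefD t f g : coef t (f + g) = coef t f + coef t g.
Proof. by []. Qed.

Lemma fcoefZ t a f : coef t (a *: f) = a * coef t f.
Proof. by []. Qed.

Lemma fcoef0 t : coef t 0 = 0.
Proof. by []. Qed.

Lemma fcoefP (f g : free_mod) : (forall t, coef t f = coef t g) -> f = g.
Proof. by move=> fg; apply/val_inj/funext. Qed.

Lemma delta_finsupp t : finsupp (fun u => (u == t)%:R).
Proof. by exists [:: t] => u; rewrite inE => /negPf ->. Qed.

Definition delta (t : T) : free_mod := @mksubm _ _ fin_submod _ (delta_finsupp t).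

Lemma coef_delta t u : coef u (delta t) = (u == t)%:R.
Proof. by []. Qed.

Lemma free_support (f : free_mod) :
  exists s : seq T, uniq s /\ forall t, coef t f != 0 -> t \in s.
Proof.
have [s hs] := subm_in f; exists (undup s); split; first exact: undup_uniq.
by move=> t; rewrite mem_undup; apply: contraNT => /hs /eqP.
Qed.

(** A chosen duplicate-free list that contains the support; it may also contain points where [f]
    vanishes. By [free_sum] any other such list gives the same linear combination. *)
Definition supp (f : free_mod) : seq T := sval (cid (free_support f)).

Lemma supp_uniq f : uniq (supp f).
Proof. by rewrite /supp; case: cid => s []. Qed.

Lemma mem_supp f t : coef t f != 0 -> t \in supp f.
Proof. by rewrite /supp; case: cid => s [_] /= h /h. Qed.

Lemma free_sum (V : lmodType R) (phi : T -> V) (f : free_mod) (s : seq T) :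
  uniq s -> (forall t, coef t f != 0 -> t \in s) ->
  \sum_(t <- supp f) coef t f *: phi t = \sum_(t <- s) coef t f *: phi t.
Proof.
move=> s_uniq s_supp.
have aux (r : seq T) : uniq r -> (forall t, coef t f != 0 -> t \in r) ->
    \sum_(t <- r) coef t f *: phi t =
    \sum_(t <- [seq t <- supp f | coef t f != 0]) coef t f *: phi t.
  move=> r_uniq r_supp.
  rewrite (bigID (fun t => coef t f == 0)) /= big1 ?add0r; last first.
    by move=> t /eqP ->; rewrite scale0r.
  rewrite -big_filter; apply/perm_big/uniq_perm.
  - exact: filter_uniq.
  - exact/filter_uniq/supp_uniq.
  move=> t; rewrite !mem_filter.
  by case: (boolP (coef t f == 0)) => //= f0; rewrite r_supp ?mem_supp.
rewrite (aux s) // (aux (supp f) (supp_uniq f) (@mem_supp f)) //.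
Qed.

Section Lift.
Variables (V : lmodType R) (phi : T -> V).

Definition flift_fun (f : free_mod) : V := \sum_(t <- supp f) coef t f *: phi t.

Lemma flift_linear : linear flift_fun.
Proof.
move=> a f g.
have us : uniq (undup (supp f ++ supp g)) by exact: undup_uniq.
rewrite /flift_fun !(@free_sum _ _ _ (undup (supp f ++ supp g))) //.
- rewrite scaler_sumr -big_split /=; apply: eq_bigr => t _.
  by rewrite fcoefZD scalerDl scalerA.
- by move=> t /mem_supp; rewrite mem_undup mem_cat => ->; rewrite orbT.
- by move=> t /mem_supp; rewrite mem_undup mem_cat => ->.
- move=> t; rewrite mem_undup mem_cat fcoefZD => h.
  have [/mem_supp -> //|] := boolP (coef t f != 0).
  rewrite negbK => /eqP f0; move: h; rewrite f0 mulr0 add0r => /mem_supp ->.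
  by rewrite orbT.
Qed.

Definition flift : {linear free_mod -> V} := mklin flift_linear.

Lemma flift_delta t : flift (delta t) = phi t.
Proof.
rewrite /= /flift_fun (@free_sum _ _ _ [:: t]) //.
  by rewrite big_seq1 coef_delta eqxx scale1r.
by move=> u; rewrite coef_delta inE; case: (u == t) => //; rewrite eqxx.
Qed.

Lemma fliftE f s : uniq s -> (forall t, coef t f != 0 -> t \in s) ->
  flift f = \sum_(t <- s) coef t f *: phi t.
Proof. exact: free_sum. Qed.

End Lift.

Lemma coef_sum_delta s (c : T -> R) u : uniq s ->
  coef u (\sum_(t <- s) c t *: delta t) = if u \in s then c u else 0.
Proof.
move=> s_uniq; rewrite linear_sum /=; case: ifPn => [us|us].
  rewrite (bigD1_seq u) //= fcoefZ coef_delta eqxx mulr1 big1 ?addr0 //.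
  by move=> t tu; rewrite fcoefZ coef_delta eq_sym (negPf tu) mulr0.
rewrite big_seq big1 // => t ts; rewrite fcoefZ coef_delta.
case: eqP => [ut|_]; last by rewrite mulr0.
by rewrite ut ts in us.
Qed.

Lemma free_expand f s : uniq s -> (forall t, coef t f != 0 -> t \in s) ->
  f = \sum_(t <- s) coef t f *: delta t.
Proof.
move=> s_uniq s_supp; apply: fcoefP => u; rewrite coef_sum_delta //.
by case: ifPn => // /(contra (s_supp u)); rewrite negbK => /eqP.
Qed.

(** The predicate [W] carries a bound on the support through the induction; later it is a bound on a
    degree or a rank. *)
Lemma free_ind (W : T -> Prop) (P : free_mod -> Prop) :
  P 0 -> (forall f g, P f -> P g -> P (f + g)) ->
  (forall r t, W t -> P (r *: delta t)) ->
  forall f, (forall t, coef t f <> 0 -> W t) -> P f.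
Proof.
move=> P0 PD Pd f fW; rewrite (free_expand (supp_uniq f) (@mem_supp f)).
apply: (big_ind P) => // t _.
have [->|/eqP/fW Wt] := eqVneq (coef t f) 0; first by rewrite scale0r.
exact: Pd.
Qed.

Lemma flift_unique (V : lmodType R) (f g : {linear free_mod -> V}) :
  (forall t, f (delta t) = g (delta t)) -> f =1 g.
Proof.
move=> fg h.
apply: (@free_ind xpredT (fun h => f h = g h)) => //.
- by rewrite !linear0.
- by move=> u v fu fv; rewrite !linearD fu fv.
by move=> r t _; rewrite !linearZ fg.
Qed.

Lemma free_projective : projective free_mod.
Proof.
move=> M N g f /choice[s sK]; exists (flift (s \o f \o delta)) => p.
apply: (@flift_unique _ (lincomp g (flift (s \o f \o delta))) f) => t.
by rewrite -[RHS]sK; congr (g _); exact: flift_delta.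
Qed.

End FreeModule.

(** * Projective dimension *)

Section ProjectiveDimension.
Variable R : pzRingType.
Implicit Types K L M N P Q E Z : lmodType R.

Record short_exact K P M (i : {linear K -> P}) (p : {linear P -> M}) : Prop :=
  ShortExact {
    se_inj : injective i;
    se_surj : surjective_map p;
    se_exact : exact_at i p }.

(** A recursive form of [proj_dim_le], with one short exact sequence per step, suited to dimension
    shifting. The two agree by [proj_dim_le_pdle] and [pdle_proj_dim_le]. *)
Fixpoint pdle (d : nat) M : Prop :=
  if d is d'.+1 then
    exists K P (i : {linear K -> P}) (p : {linear P -> M}),
      [/\ projective P, short_exact i p & pdle d' K]
  else projective M.

Lemma ker_se M N (f : {linear M -> N}) :
  surjective_map f -> short_exact (subm_incl (ker f)) f.
Proof. by move=> f_surj; split; [exact: subm_incl_inj| |exact: ker_exact]. Qed.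

Lemma projective_retract M N (s : {linear M -> N}) (p : {linear N -> M}) :
  cancel s p -> projective N -> projective M.
Proof.
move=> sK projN X Y g f g_surj.
have [h hK] := projN X Y g (lincomp f p) g_surj.
by exists (lincomp h s) => m; rewrite /= hK /= sK.
Qed.

Lemma se_comp_iso K P M M' (i : {linear K -> P}) (p : {linear P -> M})
    (f : {linear M -> M'}) :
  bijective f -> short_exact i p -> short_exact i (lincomp f p).
Proof.
move=> [g fK gK] [i_inj p_surj ip]; split=> //.
- by move=> v; have [u pu] := p_surj (g v); exists u; rewrite /= pu gK.
- move=> v; rewrite -ip /=; split=> [fp|->]; last exact: linear0.
  by apply: (can_inj fK); rewrite fp linear0.
Qed.

Lemma pdle_iso d M M' (f : {linear M -> M'}) :
  bijective f -> pdle d M -> pdle d M'.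
Proof.
case: d => [|d] f_bij; last first.
  move=> [K [P [i [p [projP se pdK]]]]].
  by exists K, P, i, (lincomp f p); split=> //; exact: se_comp_iso.
have [g' fK' gK'] := f_bij.
have [|y|g [fK gK]] := @lin_inv _ _ _ f; first exact: can_inj fK'.
  by exists (g' y).
exact: (@projective_retract _ _ g f).
Qed.

Lemma fst_linear M N : linear (fun u : M * N => u.1). Proof. by []. Qed.
Lemma snd_linear M N : linear (fun u : M * N => u.2). Proof. by []. Qed.
Definition lfst M N : {linear (M * N)%type -> M} := mklin (@fst_linear M N).
Definition lsnd M N : {linear (M * N)%type -> N} := mklin (@snd_linear M N).

Lemma inl_linear M N : linear (fun m : M => (m, 0) : M * N).
Proof. by move=> a u v; congr pair; rewrite /= scaler0 addr0. Qed.
Lemma inr_linear M N : linear (fun n : N => (0, n) : M * N).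
Proof. by move=> a u v; congr pair; rewrite /= scaler0 addr0. Qed.
Definition linl M N : {linear M -> (M * N)%type} := mklin (@inl_linear M N).
Definition linr M N : {linear N -> (M * N)%type} := mklin (@inr_linear M N).

Lemma pair_linear M N E (f : {linear E -> M}) (g : {linear E -> N}) :
  linear (fun e => (f e, g e)).
Proof. by move=> a u v; rewrite !linearP. Qed.
Definition lpair M N E f g : {linear E -> (M * N)%type} :=
  mklin (@pair_linear M N E f g).

Lemma copair_linear M N E (f : {linear M -> E}) (g : {linear N -> E}) :
  linear (fun u => f u.1 + g u.2).
Proof.
by move=> a u v; rewrite !linearP scalerDr addrACA.
Qed.
Definition lcopair M N E f g : {linear (M * N)%type -> E} :=
  mklin (@copair_linear M N E f g).

Lemma projective_prod P Q : projective P -> projective Q -> projective (P * Q)%type.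
Proof.
move=> projP projQ M N g f g_surj.
have [h hK] := projP M N g (lincomp f (linl P Q)) g_surj.
have [k kK] := projQ M N g (lincomp f (linr P Q)) g_surj.
exists (lcopair h k) => -[p q]; rewrite linearD hK kK.
rewrite -[LHS](linearD f (p, 0) (0, q)).
by congr (f _); congr pair; rewrite /= ?addr0 ?add0r.
Qed.

Definition prod_map M N M' N' (f : {linear M -> M'}) (g : {linear N -> N'}) :
  {linear (M * N)%type -> (M' * N')%type} :=
  lpair (lincomp f (lfst M N)) (lincomp g (lsnd M N)).

Lemma se_prod K P M K' P' M' (i : {linear K -> P}) (p : {linear P -> M})
    (i' : {linear K' -> P'}) (p' : {linear P' -> M'}) :
  short_exact i p -> short_exact i' p' ->
  short_exact (prod_map i i') (prod_map p p').
Proof.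
move=> [i_inj p_surj ip] [i'_inj p'_surj ip']; split.
- by move=> [a b] [c d] /= [/i_inj -> /i'_inj ->].
- by move=> [a b]; have [u <-] := p_surj a; have [v <-] := p'_surj b; exists (u, v).
- move=> [a b]; split=> /= [[/ip[u <-] /ip'[v <-]]|[[u v] /= [<- <-]]].
    by exists (u, v).
  by congr pair; [apply/ip; exists u|apply/ip'; exists v].
Qed.

Lemma zero_exists : exists Z : lmodType R, forall z : Z, z = 0.
Proof. by exists 'rV[R]_0 => z; apply/matrixP => i []. Qed.

Lemma zero_projective Z : (forall z : Z, z = 0) -> projective Z.
Proof.
move=> Z0 X Y g f _; exists (linzero Z X) => z /=.
by rewrite (Z0 z) !linear0.
Qed.

Lemma se_id Z M : (forall z : Z, z = 0) -> short_exact (linzero Z M) (linid M).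
Proof.
move=> Z0; split=> [u v _|v|v]; first by rewrite (Z0 u) (Z0 v).
  by exists v.
by split=> [/= ->|[u <-]] //; exists 0.
Qed.

Lemma pdleS d M : pdle d M -> pdle d.+1 M.
Proof.
elim: d M => [M projM|d IH M [K [P [i [p [projP se pdK]]]]]].
  have [Z Z0] := zero_exists.
  exists Z, M, (linzero Z M), (linid M).
  by split=> //; [exact: se_id|exact: zero_projective].
by exists K, P, i, p; split=> //; apply: IH.
Qed.

Lemma pdle_leq d e M : (d <= e)%N -> pdle d M -> pdle e M.
Proof.
by move=> /subnK <-; elim: (e - d)%N => // k IH /IH /pdleS.
Qed.

Lemma projective_pdle d M : projective M -> pdle d M.
Proof. exact: (@pdle_leq 0). Qed.

Lemma pdle_prodr d K P : projective P -> pdle d K -> pdle d (K * P)%type.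
Proof.
case: d => [projP projK|d projP [L [Q [i [q [projQ se pdL]]]]]].
  exact: projective_prod.
have [Z Z0] := zero_exists.
exists (L * Z)%type, (Q * P)%type.
exists (prod_map i (linzero Z P)), (prod_map q (linid P)); split.
- exact: projective_prod.
- by apply: se_prod => //; exact: se_id.
apply: (@pdle_iso _ L _ (linl L Z)) => //.
by exists fst => // -[l z] /=; rewrite (Z0 z).
Qed.

Lemma se_split_iso L E P (i : {linear L -> E}) (p : {linear E -> P}) :
  projective P -> short_exact i p ->
  exists f : {linear (L * P)%type -> E}, bijective f.
Proof.
move=> projP [i_inj p_surj ip].
have [s sK] := projP E P p (linid P) p_surj.
exists (lcopair i s).
have pi l : p (i l) = 0 by apply/ip; exists l.
have f_inj : injective (lcopair i s).
  move=> [a b] [c d] /= e.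
  have bd : b = d.
    by have := congr1 p e; rewrite !linearD !pi !add0r !sK.
  by move: e; rewrite bd => /addIr /i_inj ->.
have f_surj : surjective_map (lcopair i s).
  move=> e; have [|l il] := (ip (e - s (p e))).1; first by rewrite linearB sK subrr.
  by exists (l, p e); rewrite /= il subrK.
by have [g [fK gK]] := lin_inv f_inj f_surj; exists g.
Qed.

Lemma bij_lin_inv M N (f : {linear M -> N}) :
  bijective f -> exists g : {linear N -> M}, bijective g.
Proof.
move=> [g' fK gK].
have [||g [fK' gK']] := @lin_inv _ _ _ f; first exact: can_inj fK.
  by move=> y; exists (g' y).
by exists g, f.
Qed.

Lemma pdle_ext d L E P (i : {linear L -> E}) (p : {linear E -> P}) :
  projective P -> short_exact i p -> pdle d L -> pdle d E.
Proof.
move=> projP se pdL; have [f f_bij] := se_split_iso projP se.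
exact: pdle_iso f_bij (pdle_prodr projP pdL).
Qed.

Lemma se_comp_surj M N P (f : {linear P -> M}) (g : {linear M -> N}) :
  surjective_map f -> surjective_map g -> surjective_map (lincomp g f).
Proof.
by move=> fs gs n; have [m <-] := gs n; have [p <-] := fs m; exists p.
Qed.

(** If [L] is the kernel of the cover of [K * P] by [Q], the kernel of the composite from [Q] to [K]
    is an extension of [P] by [L]. This extension splits, so its dimension is bounded by that of
    [L]. *)
Lemma pdle_prod_cancel d K P : projective P -> pdle d (K * P)%type -> pdle d K.
Proof.
case: d => [projP projKP|d projP [L [Q [i [q [projQ se pdL]]]]]].
  by apply: (@projective_retract _ _ (linl K P) (lfst K P)).
have [i_inj q_surj iq] := se.
have s1 : surjective_map (lincomp (lfst K P) q).
  by apply: se_comp_surj => // k; exists (k, 0).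
exists (subm (ker (lincomp (lfst K P) q))), Q.
exists (subm_incl _), (lincomp (lfst K P) q); split=> //; first exact: ker_se.
have k1 l : sm_pred (ker (lincomp (lfst K P) q)) (i l).
  by rewrite /= (_ : q (i l) = 0) //; apply/iq; exists l.
apply: (@pdle_ext d L _ P (corestrict k1)
          (lincomp (lincomp (lsnd K P) q) (subm_incl _))) => //; split.
- by move=> a b /(congr1 val) /i_inj.
- move=> x; have [u qu] := q_surj (0, x).
  have ku : sm_pred (ker (lincomp (lfst K P) q)) u by rewrite /= qu.
  by exists (mksubm ku); rewrite /= qu.
- move=> v; have := subm_in v; rewrite /= => v1; split=> [v2|[l <-]].
    have [|l il] := (iq (val v)).1; first by case: (q _) v1 v2 => /= ? ? -> ->.
    by exists l; apply: val_inj.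
  by rewrite /= (_ : q (i l) = 0) //; apply/iq; exists l.
Qed.

(* Schanuel's lemma, through the pullback of the two covers. *)
Lemma pdle_syzygy d M K P (i : {linear K -> P}) (p : {linear P -> M}) :
  projective P -> short_exact i p -> pdle d.+1 M -> pdle d K.
Proof.
move=> projP se [K' [P' [i' [p' [projP' se' pdK']]]]].
have [i_inj p_surj ip] := se; have [i'_inj p'_surj ip'] := se'.
have D_lin : linear (fun u : P * P' => p u.1 - p' u.2).
  by move=> a u v; rewrite /= !linearP /= scalerBr scalerN addrACA.
pose D := mklin D_lin.
have p0 k : p (i k) = 0 by apply/ip; exists k.
have p'0 k : p' (i' k) = 0 by apply/ip'; exists k.
have DE (e : subm (ker D)) : p (val e).1 = p' (val e).2.
  by apply/eqP; rewrite -subr_eq0; apply/eqP; exact: (val_ker e).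
have k'D k : D (linr P P' (i' k)) = 0 by rewrite /= linear0 p'0 subrr.
have kD k : D (linl P P' (i k)) = 0 by rewrite /= linear0 p0 subrr.
pose j' := corestrict (S := ker D) (f := lincomp (linr P P') i') k'D.
pose j := corestrict (S := ker D) (f := lincomp (linl P P') i) kD.
have se1 : short_exact j' (lincomp (lfst P P') (subm_incl (ker D))).
  split.
  - by move=> a b /(congr1 val) [/i'_inj].
  - move=> u; have [u' pu'] := p'_surj (p u).
    have Du : D (u, u') = 0 by rewrite /= pu' subrr.
    by exists (mksubm (S := ker D) Du).
  - move=> e; have := DE e; split=> /= [e1|[k <-]] //.
    have [|k ik] := (ip' (val e).2).1; first by rewrite -DE e1 linear0.
    by exists k; apply: val_inj; rewrite /= ik -e1 -surjective_pairing.
have se2 : short_exact j (lincomp (lsnd P P') (subm_incl (ker D))).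
  split.
  - by move=> a b /(congr1 val) [/i_inj].
  - move=> u'; have [u pu] := p_surj (p' u').
    have Du : D (u, u') = 0 by rewrite /= pu subrr.
    by exists (mksubm (S := ker D) Du).
  - move=> e; have := DE e; split=> /= [e1|[k <-]] //.
    have [|k ik] := (ip (val e).1).1; first by rewrite DE e1 linear0.
    by exists k; apply: val_inj; rewrite /= ik -e1 -surjective_pairing.
have pdE := pdle_ext projP se1 pdK'.
have [f f_bij] := se_split_iso projP' se2.
have [g g_bij] := bij_lin_inv f_bij.
exact: pdle_prod_cancel projP' (pdle_iso g_bij pdE).
Qed.

Definition free_cover M : {linear free_mod R M -> M} := flift (fun m : M => m).

Lemma free_cover_surj M : surjective_map (free_cover M).
Proof. by move=> m; exists (delta R m); exact: flift_delta. Qed.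

(** The product of the free covers of [M] and [N] has the product of their kernels as its kernel, so
    the claim descends to the syzygies and ends with a retract of a projective module. *)
Lemma pdle_summand d M N : pdle d (M * N)%type -> pdle d M.
Proof.
elim: d M N => [|d IH] M N pdMN.
  by apply: (@projective_retract _ _ (linl M N) (lfst M N)).
exists (subm (ker (free_cover M))), (free_mod R M), (subm_incl _), (free_cover M).
have seM := ker_se (@free_cover_surj M); have seN := ker_se (@free_cover_surj N).
split=> //; first exact: free_projective.
apply: (IH _ (subm (ker (free_cover N)))).
apply: pdle_syzygy (se_prod seM seN) pdMN.
by apply: projective_prod; exact: free_projective.
Qed.

Lemma zero_bij M N (f : {linear M -> N}) :
  (forall v, f v = 0 -> v = 0) -> surjective_map f -> bijective f.
Proof.
move=> f0 f_surj.
have f_inj : injective f.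
  by move=> u v fuv; apply/eqP; rewrite -subr_eq0; apply/eqP/f0;
    rewrite linearB fuv subrr.
by have [g [fK gK]] := lin_inv f_inj f_surj; exists g.
Qed.

Lemma proj_dim_le_pdle d M : proj_dim_le d M -> pdle d M.
Proof.
elim: d M => [|d IH] M [P [f [eps [[projP eps_surj ex0 exS] P0]]]].
  have eps0 v : eps v = 0 -> v = 0.
    move=> /(ex0 v)[u fu]; have u0 : u = 0 by exact: P0.
    by move: fu; rewrite u0 linear0.
  exact: (@pdle_iso 0 _ _ eps (zero_bij eps0 eps_surj) (projP 0)).
exists (subm (ker eps)), (P 0), (subm_incl _), eps; split=> //; first exact: ker_se.
have f0 u : sm_pred (ker eps) (f 0 u) by apply/ex0; exists u.
(* The resolution shifted by one resolves the kernel of [eps]. *)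
apply: IH; exists (fun i => P i.+1), (fun i => f i.+1), (corestrict f0).
split; last by move=> i di; exact: P0.
split=> //.
- move=> v; have /ex0[u fu] := val_ker v.
  by exists u; apply: val_inj.
- move=> v; rewrite -(exS 0); split=> [/(congr1 val)//|fv].
  exact: val_inj.
Qed.

Lemma pdle_proj_dim_le d M : pdle d M -> proj_dim_le d M.
Proof.
elim: d M => [|d IH] M.
  have [Z Z0] := zero_exists => projM.
  pose P i := if i is i'.+1 then Z else M.
  exists P, (fun i => linzero (P i.+1) (P i)), (linid M).
  split; last by case.
  split.
  - by case=> //= i; exact: zero_projective.
  - by move=> v; exists v.
  - by move=> v; split=> [/= ->|[u <-]] //; exists 0.
  - by move=> i v; split=> // _; exists 0; rewrite [v]Z0.
move=> [K [Q [j [p [projQ [j_inj p_surj ip] /IH[P [f [eps [[projP eps_surj ex0 exS] P0]]]]]]]]].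
pose P' i := if i is i'.+1 then P i' else Q.
pose f' i : {linear P' i.+1 -> P' i} :=
  match i return {linear P' i.+1 -> P' i} with
  | i'.+1 => f i' | 0 => lincomp j eps
  end.
exists P', f', p; split; last by case=> // i di; exact: P0.
split=> //.
- by case.
- move=> v; rewrite (ip v); split=> [[k jk]|[u fu]]; last by exists (eps u).
  by have [u eu] := eps_surj k; exists u; rewrite /= eu.
- case=> [|i] v; last exact: exS.
  rewrite -(ex0 v); split=> [/= ev|ev]; last by rewrite /= ev linear0.
  by apply: j_inj; rewrite linear0.
Qed.

End ProjectiveDimension.

(** * Restriction of scalars *)

(** The morphism [h] tags the carrier, so that the structure over [R] attached to it stays distinct
    from the one over [A]. *)
Definition res (R A : pzRingType) (h : {rmorphism R -> A}) (M : lmodType A) : Type := M.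

Section RestrictionOfScalars.
Variables (R A : pzRingType) (h : {rmorphism R -> A}).

Section Carrier.
Variable M : lmodType A.

HB.instance Definition _ := GRing.Zmodule.copy (res h M) M.

Fact res_scaleA (a b : R) (m : res h M) : h a *: (h b *: (m : M)) = h (a * b) *: (m :
  M).
Proof. by rewrite scalerA rmorphM. Qed.
Fact res_scale1 (m : res h M) : h 1 *: (m : M) = m.
Proof. by rewrite rmorph1 scale1r. Qed.
Fact res_scaleDr (a : R) (m m' : res h M) : h a *: ((m : M) + m') = h a *: (m :
  M) + h a *: (m' : M).
Proof. exact: scalerDr. Qed.
Fact res_scaleDl (m : res h M) (a b : R) : h (a + b) *: (m : M) = h a *: (m :
  M) + h b *: (m : M).
Proof. by rewrite rmorphD scalerDl. Qed.

HB.instance Definition _ := GRing.Zmodule_isLmodule.Build R (res h M)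
  res_scaleA res_scale1 res_scaleDr (fun m a b => res_scaleDl m a b).

Lemma res_scaleE (a : R) (m : res h M) : a *: m = h a *: (m : M).
Proof. by []. Qed.

End Carrier.

Lemma res_lin_linear (M N : lmodType A) (f : {linear M -> N}) :
  linear (f : res h M -> res h N).
Proof. by move=> a u v; rewrite !res_scaleE linearP. Qed.

Definition res_lin M N f : {linear res h M -> res h N} := mklin (@res_lin_linear M N f).

Lemma se_res (K P M : lmodType A) (i : {linear K -> P}) (p : {linear P -> M}) :
  short_exact i p -> short_exact (res_lin i) (res_lin p).
Proof. by case=> i_inj p_surj ip; split. Qed.

End RestrictionOfScalars.

Section Twist.
Variables (R A : pzRingType) (h : {rmorphism R -> A}) (h' : {rmorphism A -> R}).
Hypotheses (hK : cancel h h') (h'K : cancel h' h).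

(** Restriction along [h'] turns a lifting problem over [R] into one over [A]; since [h] and [h']
    are inverse to each other, the solution is again linear over [R]. *)
Lemma projective_twist (M : lmodType A) : projective M -> projective (res h M).
Proof.
move=> projM X Y g f g_surj.
have f'_lin : linear (f : M -> res h' Y).
  by move=> a u v; rewrite res_scaleE -linearP; congr (f (_ + _));
    rewrite res_scaleE h'K.
have [k kK] := projM (res h' X) (res h' Y) (res_lin h' g) (mklin f'_lin) g_surj.
have k'_lin : linear (k : res h M -> X).
  by move=> a u v; rewrite linearP res_scaleE hK.
by exists (mklin k'_lin).
Qed.

Lemma pdle_twist d (M : lmodType A) : pdle d M -> pdle d (res h M).
Proof.
elim: d M => [|d IH] M; first exact: projective_twist.
move=> [K [P [i [p [projP se /IH pdK]]]]].
exists (res h K), (res h P), (res_lin h i), (res_lin h p).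
by split; [exact: projective_twist|exact: se_res|].
Qed.

End Twist.

Section Preimage.
Variables (R : pzRingType) (M N : lmodType R) (f : {linear M -> N}) (S : submod N).

Lemma preim_submod0 : sm_pred S (f 0).
Proof. by rewrite linear0; exact: sm0. Qed.

Lemma preim_submodP a u v :
  sm_pred S (f u) -> sm_pred S (f v) -> sm_pred S (f (a *: u + v)).
Proof. by move=> Su Sv; rewrite linearP; exact: smP. Qed.

Definition preim_submod : submod M :=
  @Submod R M (fun v => sm_pred S (f v)) preim_submod0 preim_submodP.

End Preimage.

Section SubmoduleTheory.
Variables (R : pzRingType) (M : lmodType R) (S : submod M).

Lemma smD u v : sm_pred S u -> sm_pred S v -> sm_pred S (u + v).
Proof. by move=> Su Sv; rewrite -[u]scale1r; exact: smP. Qed.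

Lemma smZ a u : sm_pred S u -> sm_pred S (a *: u).
Proof. by move=> Su; rewrite -[_ *: u]addr0; apply: smP => //; exact: sm0. Qed.

Lemma smN u : sm_pred S u -> sm_pred S (- u).
Proof. by rewrite -scaleN1r; exact: smZ. Qed.

Lemma smB u v : sm_pred S u -> sm_pred S v -> sm_pred S (u - v).
Proof. by move=> Su Sv; apply: smD => //; exact: smN. Qed.

Lemma sm_sum (I : Type) (s : seq I) (P : pred I) (F : I -> M) :
  (forall i, P i -> sm_pred S (F i)) -> sm_pred S (\sum_(i <- s | P i) F i).
Proof. by move=> SF; apply: big_ind => //; [exact: sm0|exact: smD]. Qed.

Lemma lift_sm (T : choiceType) (phi : T -> M) (f : free_mod R T) :
  (forall t, coef t f <> 0 -> sm_pred S (phi t)) -> sm_pred S (flift phi f).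
Proof.
move=> phiS; apply: sm_sum => t _.
have [->|/eqP/phiS] := eqVneq (coef t f) 0; last exact: smZ.
by rewrite scale0r; exact: sm0.
Qed.

End SubmoduleTheory.

(** * Auslander's lemma *)

(* [q k] identifies the [k]-th factor [S k.+1 / S k] with the submodule [Q k]
   of [X k]. *)
Record filtration (R : pzRingType) (M : lmodType R) (S : nat -> submod M)
    (X : nat -> lmodType R) (q : forall k, {linear M -> X k})
    (Q : forall k, submod (X k)) : Prop := Filtration {
  filtr0 : forall v, sm_pred (S 0) v -> v = 0;
  filtr_cover : forall v, exists k, sm_pred (S k) v;
  filtr_mono : forall k v, sm_pred (S k) v -> sm_pred (S k.+1) v;
  filtr_im : forall k v, sm_pred (S k.+1) v -> sm_pred (Q k) (q k v);
  filtr_surj : forall k x, sm_pred (Q k) x -> exists v, sm_pred (S k.+1) v /\ q k v = x;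
  filtr_ker : forall k v, sm_pred (S k.+1) v -> q k v = 0 <-> sm_pred (S k) v }.

Section Filtration.
Variables (R : pzRingType) (M : lmodType R) (S : nat -> submod M).
Variables (X : nat -> lmodType R) (q : forall k, {linear M -> X k}).
Variable (Q : forall k, submod (X k)).
Hypothesis SQ : filtration S q Q.

Let S0 := filtr0 SQ.
Let S_cover := filtr_cover SQ.
Let S_mono := filtr_mono SQ.
Let q_im := filtr_im SQ.
Let q_surj := filtr_surj SQ.
Let q_ker := filtr_ker SQ.

Lemma filtr_leq j k v : (j <= k)%N -> sm_pred (S j) v -> sm_pred (S k) v.
Proof. by move=> /subnK <- Sv; elim: (k - j)%N => // i IH; exact: S_mono. Qed.

Lemma filtr_q0 k v : sm_pred (S k) v -> q k v = 0.
Proof. by move=> Sv; apply/q_ker => //; exact: S_mono. Qed.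

(** Each factor splits off, so [M] is in effect the direct sum of the [Q k]. A lift is built by
    lifting on the sections [s k] and peeling off one factor at a time. *)
Lemma filtered_projective : (forall k, projective (subm (Q k))) -> projective M.
Proof.
move=> projQ Y Z g f g_surj.
have qS k (v : subm (S k.+1)) : sm_pred (Q k) (q k (val v)).
  by apply: q_im; exact: subm_in.
pose qq k := corestrict (f := lincomp (q k) (subm_incl (S k.+1))) (qS k).
have qq_surj k : surjective_map (qq k).
  move=> x; have [v [Sv qv]] := q_surj (subm_in x).
  by exists (mksubm Sv); apply: val_inj.
have s_ex k : exists s : {linear subm (Q k) -> subm (S k.+1)},
    forall x, q k (val (s x)) = val x.
  have [s sK] := projQ k _ _ (qq k) (linid _) (qq_surj k).
  by exists s => x; have /(congr1 val) := sK x.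
pose s k := sval (cid (s_ex k)).
have sK k x : q k (val (s k x)) = val x by exact: (svalP (cid (s_ex k))).
have t_ex k : exists t : {linear subm (Q k) -> Y},
    forall x, g (t x) = f (val (s k x)).
  exact: (projQ k _ _ g (lincomp f (lincomp (subm_incl _) (s k))) g_surj).
pose t k := sval (cid (t_ex k)).
have tK k x : g (t k x) = f (val (s k x)) by exact: (svalP (cid (t_ex k))).
(* The class of [m] in the factor [Q k], made total by the default value 0; it is additive only on
   [S k.+1]. *)
pose z k m : subm (Q k) := insubd (0 : subm (Q k)) (q k m).
have zE k m : sm_pred (S k.+1) m -> val (z k m) = q k m.
  by move=> Sm; rewrite insubdK //; apply/asboolT/q_im.
have zP k a u v : sm_pred (S k.+1) u -> sm_pred (S k.+1) v ->
    z k (a *: u + v) = a *: z k u + z k v.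
  move=> Su Sv; apply: val_inj; rewrite linearP /= !zE //; last exact: smP.
  by rewrite linearP.
(* [h k] is the lift on [S k]: remove the section of the top class, recurse on the remainder in the
   previous step, and add the lift of that class. *)
pose h := fix h k m : Y :=
  if k is k'.+1 then h k' (m - val (s k' (z k' m))) + t k' (z k' m) else 0.
have hE k m : h k.+1 m = h k (m - val (s k (z k m))) + t k (z k m) by [].
have h_red k m : sm_pred (S k.+1) m -> sm_pred (S k) (m - val (s k (z k m))).
  move=> Sm; apply/q_ker; first by apply: smB => //; exact: subm_in.
  by rewrite linearB sK zE // subrr.
have h0 m : h 0%N m = 0 by [].
clearbody h.
have hP k a u v : sm_pred (S k) u -> sm_pred (S k) v ->
    h k (a *: u + v) = a *: h k u + h k v.
  elim: k u v => [|k IH] u v Su Sv; first by rewrite !h0 scaler0 addr0.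
  rewrite !hE zP // !linearP /= scalerDr [RHS]addrACA -IH; try exact: h_red.
  by congr (h k _ + _); rewrite scalerDr addrACA.
have gh k v : sm_pred (S k) v -> g (h k v) = f v.
  elim: k v => [|k IH] v Sv; first by rewrite h0 (S0 Sv) !linear0.
  by rewrite hE linearD IH ?tK; [rewrite -linearD subrK|exact: h_red].
have hS k v : sm_pred (S k) v -> h k.+1 v = h k v.
  move=> Sv; rewrite hE; have -> : z k v = 0.
    by apply: val_inj; rewrite zE ?filtr_q0 //; exact: S_mono.
  by rewrite !linear0 !addr0.
have h_leq j k v : (j <= k)%N -> sm_pred (S j) v -> h k v = h j v.
  move=> /subnK <- Sv; elim: (k - j)%N => // i IH.
  by rewrite addSn hS //; apply: filtr_leq Sv; exact: leq_addl.
(* The lifts [h k] agree wherever they are meaningful, so any level [ix v] containing [v] may be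
   used to glue them. *)
have [ix ixP] := choice S_cover.
have hix k v : sm_pred (S k) v -> h (ix v) v = h k v.
  by move=> Sv; rewrite -(@h_leq _ (maxn k (ix v)) _ _ (ixP v)) ?leq_maxr // (@h_leq k) ?leq_maxl.
have H_lin : linear (fun v => h (ix v) v).
  move=> a u v.
  have Su : sm_pred (S (maxn (ix u) (ix v))) u by apply: filtr_leq (ixP u);
    exact: leq_maxl.
  have Sv : sm_pred (S (maxn (ix u) (ix v))) v by apply: filtr_leq (ixP v);
    exact: leq_maxr.
  by rewrite (hix _ _ Su) (hix _ _ Sv) (hix _ _ (smP a Su Sv)) hP.
by exists (mklin H_lin) => v; exact: (gh _ _ (ixP v)).
Qed.

End Filtration.

Section FiltrationCover.
Variables (R : pzRingType) (M : lmodType R) (S : nat -> submod M).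
Variables (X : nat -> lmodType R) (q : forall k, {linear M -> X k}).
Variable (Q : forall k, submod (X k)).
Hypothesis SQ : filtration S q Q.

(** Truncation makes every pair [(k, m)] an admissible generator of the free cover, sent to 0 when
    [m] is outside [S k.+1]. Thus all layers have the same free module. *)
Definition inS k (m : M) : M := if `[< sm_pred (S k.+1) m >] then m else 0.

Lemma inS_in k m : sm_pred (S k.+1) (inS k m).
Proof. by rewrite /inS; case: asboolP => // _; exact: sm0. Qed.

Lemma inSE k m : sm_pred (S k.+1) m -> inS k m = m.
Proof. by rewrite /inS; case: asboolP. Qed.

Let F : lmodType R := free_mod R (nat * M)%type.
Let FM : lmodType R := free_mod R M.

Definition filtr_cov : {linear F -> M} := flift (fun u : nat * M => inS u.1 u.2).
Definition layer_cov k : {linear FM -> M} := flift (inS k).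
Definition layer_emb k : {linear FM -> F} := flift (fun m => delta R (k, m)).
Definition layer_proj k : {linear F -> FM} :=
  flift (fun u : nat * M => if u.1 == k then delta R u.2 else 0).

Lemma filtr_cov_delta k m : filtr_cov (delta R (k, m)) = inS k m.
Proof. exact: flift_delta. Qed.

Lemma layer_cov_delta k m : layer_cov k (delta R m) = inS k m.
Proof. exact: flift_delta. Qed.

Lemma layer_emb_delta k m : layer_emb k (delta R m) = delta R (k, m).
Proof. exact: flift_delta. Qed.

Lemma layer_proj_delta k j m :
  layer_proj k (delta R (j, m)) = if j == k then delta R m else 0.
Proof. exact: flift_delta. Qed.

Lemma filtr_cov_emb k p : filtr_cov (layer_emb k p) = layer_cov k p.
Proof.
apply: (@flift_unique _ _ _ (lincomp filtr_cov (layer_emb k)) (layer_cov k)) => m.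
rewrite -[LHS]/(filtr_cov (layer_emb k (delta R m))).
by rewrite layer_emb_delta filtr_cov_delta layer_cov_delta.
Qed.

Lemma coef_layer_emb k j m p :
  coef (j, m) (layer_emb k p) = if j == k then coef m p else 0.
Proof.
pose c : {linear FM -> R^o} := if j == k then lcoef R m else linzero _ _.
transitivity (c p); last by rewrite /c; case: ifP.
apply: (@flift_unique _ _ _ (lincomp (lcoef R (j, m)) (layer_emb k)) c) => m'.
rewrite -[LHS]/(coef (j, m) (layer_emb k (delta R m'))) layer_emb_delta coef_delta.
rewrite /c xpair_eqE; case: eqP => //= _.
Qed.

Lemma coef_layer_proj k m f : coef m (layer_proj k f) = coef (k, m) f.
Proof.
apply: (@flift_unique _ _ _ (lincomp (lcoef R m) (layer_proj k)) (lcoef R (k, m))) =>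
  -[j m'].
rewrite -[LHS]/(coef m (layer_proj k (delta R (j, m')))) layer_proj_delta.
rewrite -[RHS]/(coef (k, m) (delta R (j, m'))) coef_delta xpair_eqE [k == j]eq_sym.
by case: eqP.
Qed.

Lemma layer_cov_in k p : sm_pred (S k.+1) (layer_cov k p).
Proof. by apply: lift_sm => m _; exact: inS_in. Qed.

Definition below_pred k (f : F) := forall j m, (k <= j)%N -> coef (j, m) f = 0.

Lemma below0 k : below_pred k 0. Proof. by []. Qed.

Lemma belowP k a f g : below_pred k f -> below_pred k g -> below_pred k (a *: f + g).
Proof. by move=> hf hg j m kj; rewrite fcoefZD hf ?hg // mulr0 addr0. Qed.

Definition below k := Submod (@below0 k) (@belowP k).

Lemma filtr_cov_below k f : below_pred k f -> sm_pred (S k) (filtr_cov f).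
Proof.
move=> fk; apply: lift_sm => -[j m] /= fjm.
apply: (filtr_leq SQ _ (inS_in j m)); rewrite ltnNge; apply/negP => kj.
by rewrite fk in fjm.
Qed.

Lemma below_filtr_cov k v : sm_pred (S k) v -> exists f, below_pred k f /\
  filtr_cov f = v.
Proof.
case: k => [|k] Sv.
  by exists 0; split=> //; rewrite linear0 (filtr0 SQ Sv).
exists (delta R (k, v)); split; last by rewrite filtr_cov_delta inSE.
by move=> j m kj; rewrite coef_delta xpair_eqE gtn_eqF.
Qed.

Lemma filtr_cov_surj : surjective_map filtr_cov.
Proof.
move=> v; have [k Sv] := filtr_cover SQ v.
by have [f [_ fv]] := below_filtr_cov Sv; exists f.
Qed.

Lemma below_layer k f : below_pred k.+1 f ->
  below_pred k (f - layer_emb k (layer_proj k f)).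
Proof.
move=> fk j m; rewrite leq_eqVlt => /predU1P[<-|kj];
  rewrite fcoefD -scaleN1r fcoefZ coef_layer_emb coef_layer_proj.
  by rewrite eqxx mulN1r subrr.
by rewrite fk // gtn_eqF // mulr0 addr0.
Qed.

Lemma below_layer_emb k p : below_pred k.+1 (layer_emb k p).
Proof. by move=> j m kj; rewrite coef_layer_emb gtn_eqF. Qed.

Definition layer_syz k : submod FM := ker (lincomp (q k) (layer_cov k)).

(** The cover maps the layers below [k] onto [S k]. This strictness makes the factors of the kernel,
    filtered by layers, equal to the kernels of the covers of the [Q k]. *)
Lemma filtr_syzygy :
  filtration (fun k => preim_submod (subm_incl (ker filtr_cov)) (below k))
    (fun k => lincomp (layer_proj k) (subm_incl (ker filtr_cov))) layer_syz.
Proof.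
split.
- move=> v v0; apply: val_inj; apply: fcoefP => -[j m]; exact: v0.
- move=> v; exists (\max_(u <- supp (val v)) u.1).+1 => j m.
  rewrite ltnNge => /negP mj; apply/eqP/negP => /negP /mem_supp vjm; apply: mj.
  by rewrite (big_rem _ vjm) /= leq_maxl.
- by move=> k v vk j m /ltnW; exact: vk.
(* As [v] maps to 0, its top layer has the opposite image of its lower layers; that image lies in
   [S k] and is killed by [q k]. *)
- move=> k v vk; change (q k (layer_cov k (layer_proj k (val v))) = 0).
  rewrite -filtr_cov_emb.
  have e : filtr_cov (layer_emb k (layer_proj k (val v))) =
      - filtr_cov (val v - layer_emb k (layer_proj k (val v))).
    by rewrite linearB (val_ker v) sub0r opprK.
  rewrite e linearN (filtr_q0 SQ) ?oppr0 //.
  exact/filtr_cov_below/below_layer.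
(* The image of [p] lies in [S k], hence equals the image of some [f] in lower layers; the
   difference is a kernel element with top layer [p]. *)
- move=> k p /= p0.
  have Sp : sm_pred (S k) (layer_cov k p).
    by apply/(filtr_ker SQ) => //; exact: layer_cov_in.
  have [f [fk fp]] := below_filtr_cov Sp.
  have kerf : sm_pred (ker filtr_cov) (layer_emb k p - f).
    change (filtr_cov (layer_emb k p - f) = 0).
    by rewrite linearB filtr_cov_emb fp subrr.
  exists (mksubm kerf); split.
    apply: (smB (S := below k.+1)); first exact: below_layer_emb.
    by move=> j m /ltnW; exact: fk.
  apply: fcoefP => m; change (coef m (layer_proj k (layer_emb k p - f)) = coef m p).
  rewrite coef_layer_proj fcoefD -scaleN1r fcoefZ fk //.
  by rewrite mulr0 addr0 coef_layer_emb eqxx.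
- move=> k v vk; split=> [v0 j m|v0]; last first.
    by apply: fcoefP => m; rewrite coef_layer_proj v0.
  rewrite leq_eqVlt => /predU1P[<-|]; last exact: vk.
  by rewrite -coef_layer_proj [layer_proj _ _]v0.
Qed.

Lemma layer_syz_pdle d k : pdle d.+1 (subm (Q k)) -> pdle d (subm (layer_syz k)).
Proof.
have imQ p : sm_pred (Q k) (lincomp (q k) (layer_cov k) p).
  by apply: (filtr_im SQ); exact: layer_cov_in.
apply: (@pdle_syzygy _ _ _ _ _ (subm_incl _) (corestrict imQ)).
  exact: free_projective.
split=> [|x|p]; first exact: subm_incl_inj.
- have [v [Sv vx]] := filtr_surj SQ (subm_in x).
  exists (delta R v); apply: val_inj.
  by rewrite -[LHS]/(q k (layer_cov k (delta R v))) layer_cov_delta inSE.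
- rewrite -ker_exact; split=> [/(congr1 val)//|p0]; exact: val_inj.
Qed.

End FiltrationCover.

(** Induction on [d]: the kernel of the filtered free cover is filtered by the syzygies of the
    factors, whose bound is lower by one by Schanuel's lemma. *)
Lemma filtration_pdle d (R : pzRingType) (M : lmodType R) (S : nat -> submod M)
    (X : nat -> lmodType R) (q : forall k, {linear M -> X k})
    (Q : forall k, submod (X k)) :
  filtration S q Q -> (forall k, pdle d (subm (Q k))) -> pdle d M.
Proof.
elim: d M S X q Q => [|d IH] M S X q Q SQ pdQ; first exact: filtered_projective SQ pdQ.
have se := ker_se (filtr_cov_surj SQ).
exists (subm (ker (filtr_cov S))), (free_mod R (nat * M)%type), (subm_incl _),
  (filtr_cov S).
split=> //; first exact: free_projective.
apply: (IH _ _ _ _ _ (filtr_syzygy SQ)) => k.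
exact: (layer_syz_pdle SQ (pdQ k)).
Qed.

(** * Modules generated by a sequence *)

Section ChainOfGenerators.
Variables (R : pzRingType) (M : lmodType R) (W : choiceType).
Variables (y : W -> M) (rho : W -> nat).

Definition span_lt k (m : M) : Prop :=
  exists f : free_mod R W, (forall v, (k <= rho v)%N -> coef v f = 0) /\ flift y f = m.

Lemma span_lt0 k : span_lt k 0.
Proof. by exists 0; split=> //; rewrite linear0. Qed.

Lemma span_ltP k a u v : span_lt k u -> span_lt k v -> span_lt k (a *: u + v).
Proof.
move=> [f [fk <-]] [g [gk <-]]; exists (a *: f + g); split; last by rewrite linearP.
by move=> w kw; rewrite fcoefZD fk ?gk // mulr0 addr0.
Qed.

Definition span_submod k := Submod (@span_lt0 k) (@span_ltP k).

Lemma span_gen k w : (rho w < k)%N -> sm_pred (span_submod k) (y w).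
Proof.
move=> wk; exists (delta R w); split; last exact: flift_delta.
move=> v kv; rewrite coef_delta; case: eqP => // vw.
by rewrite vw leqNgt wk in kv.
Qed.

Lemma scale_linear (m : M) : linear (fun r : R^o => (r : R) *: m).
Proof. by move=> a u v; rewrite scalerDl scalerA. Qed.

Definition lscale (m : M) : {linear R^o -> M} := mklin (scale_linear m).

(** The annihilator of [y w] modulo the generators of smaller rank: when [rho] is injective, the
    factor of [M] at [w] is [R] modulo this left ideal. *)
Definition lead_ideal w : submod R^o :=
  preim_submod (lscale (y w)) (span_submod (rho w)).

Let F : lmodType R := free_mod R W.
Let K : submod F := ker (flift y).

Definition rank_lt k (f : F) := forall v, (k <= rho v)%N -> coef v f = 0.

Lemma rank_lt0 k : rank_lt k 0. Proof. by []. Qed.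

Lemma rank_ltP k a f g : rank_lt k f -> rank_lt k g -> rank_lt k (a *: f + g).
Proof. by move=> fk gk v kv; rewrite fcoefZD fk ?gk // mulr0 addr0. Qed.

Definition rank_submod k := Submod (@rank_lt0 k) (@rank_ltP k).

(** The ranks may have gaps; at a rank without generator the coefficient is 0 and so is the
    factor. *)
Definition rank_coef k : {linear F -> R^o} :=
  if pselect (exists w,
    rho w = k) is left ex then lcoef R (sval (cid ex)) else linzero _ _.

Definition rank_ideal_pred k (r : R^o) :=
  exists f : subm K, rank_lt k.+1 (val f) /\ rank_coef k (val f) = r.

Lemma rank_ideal0 k : rank_ideal_pred k 0.
Proof. by exists 0; split=> //; rewrite linear0. Qed.

Lemma rank_idealP k a u v :
  rank_ideal_pred k u -> rank_ideal_pred k v -> rank_ideal_pred k (a *: u + v).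
Proof.
move=> [f [fk <-]] [g [gk <-]]; exists (a *: f + g).
by split; [exact: rank_ltP|rewrite !linearP].
Qed.

Definition rank_ideal k := Submod (@rank_ideal0 k) (@rank_idealP k).

Hypothesis rho_inj : injective rho.

Lemma rank_filtration :
  filtration (fun k => preim_submod (subm_incl K) (rank_submod k))
    (fun k => lincomp (rank_coef k) (subm_incl K)) rank_ideal.
Proof.
split.
- by move=> v v0; apply: val_inj; apply: fcoefP => w; exact: v0.
- move=> v; exists (\max_(u <- supp (val v)) rho u).+1 => w.
  rewrite ltnNge => /negP mj; apply/eqP/negP => /negP /mem_supp vjm; apply: mj.
  by rewrite (big_rem _ vjm) /= leq_maxl.
- by move=> k v vk w /ltnW; exact: vk.
- by move=> k v vk; exists v.
- by move=> k r [f [fk <-]]; exists f.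
- move=> k v vk; rewrite /= /rank_coef; case: pselect => [ex|nex].
    case: cid => w /= wk; split=> [vw u|v0]; last by apply: v0; rewrite wk.
    rewrite leq_eqVlt => /predU1P[|]; last exact: vk.
    by rewrite -wk => /rho_inj <-.
  split=> // _ w; rewrite leq_eqVlt => /predU1P[kw|]; last exact: vk.
  by case: nex; exists w.
Qed.

(** A relation with leading term [r] at [w] amounts to an expression of [r *: y w] by generators of
    smaller rank. *)
Lemma rank_ideal_lead w r : sm_pred (rank_ideal (rho w)) r <-> sm_pred (lead_ideal w) r.
Proof.
have rcE f : rank_coef (rho w) f = coef w f.
  rewrite /rank_coef; case: pselect => [ex|[]]; last by exists w.
  by case: cid => u /= /rho_inj ->.
split.
  move=> [f [fk]]; rewrite rcE => <-.
  exists (coef w (val f) *: delta R w - val f); split=> [v wv|]; last first.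
    by rewrite linearB linearZ (val_ker f) subr0 flift_delta.
  rewrite -scaleN1r fcoefD !fcoefZ coef_delta.
  have [->|vw] := eqVneq v w; first by rewrite mulr1 mulN1r subrr.
  rewrite mulr0 add0r fk ?mulr0 // ltn_neqAle wv andbT eq_sym.
  by apply: contra vw => /eqP/rho_inj ->.
move=> [f [fk fy]].
have Kf : sm_pred K ((r : R) *: delta R w - f).
  by change (flift y ((r : R) *: delta R w - f) = 0);
    rewrite linearB linearZ flift_delta fy subrr.
exists (mksubm Kf); split=> [v wv|];
  rewrite ?rcE /= -scaleN1r fcoefD !fcoefZ coef_delta.
  by rewrite fk ?(ltnW wv) //; case: eqP => [vw|_];
    [rewrite vw ltnn in wv|rewrite !mulr0 addr0].
by rewrite eqxx mulr1 fk // mulr0 addr0.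
Qed.

(** The filtration is put on the relations among the generators instead of on [M]: its factors are
    the ideals themselves, and passing from the relations to [M] costs one dimension. *)
Lemma chain_pdle d :
  surjective_map (flift y) -> (forall w, pdle d (subm (lead_ideal w))) -> pdle d.+1 M.
Proof.
move=> y_surj pdJ.
exists (subm K), F, (subm_incl _), (flift y).
split; [exact: free_projective|exact: ker_se|].
apply: (filtration_pdle rank_filtration) => k.
have [[w <-]|nex] := pselect (exists w, rho w = k); last first.
  apply/projective_pdle/zero_projective => -[r rP]; apply: val_inj => /=.
  move: rP => /asboolP[f [_]]; rewrite /rank_coef; case: pselect => // _ /= <- //.
have RJ (u : subm (lead_ideal w)) : sm_pred (rank_ideal (rho w)) (subm_incl _ u).
  by apply/rank_ideal_lead; exact: subm_in.
apply: (@pdle_iso _ _ _ _ (corestrict RJ)) (pdJ w).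
have JR (u : subm (rank_ideal (rho w))) : sm_pred (lead_ideal w) (val u).
  by apply/rank_ideal_lead; exact: subm_in.
by exists (fun u => mksubm (JR u)) => u; apply: val_inj.
Qed.

End ChainOfGenerators.

(** * Noetherian and regular base rings *)

Section Noetherian.
Variable R : pzRingType.
Hypothesis noethR : left_noetherian R.

Lemma submod_left_ideal (S : submod R^o) : @left_ideal R (sm_pred S).
Proof.
by split=> [|a b|r a]; [exact: sm0|exact: smD|move=> Sa; exact: (@smZ _ _ S r a)].
Qed.

Lemma submod_acc (S : nat -> submod R^o) :
  (forall k r, sm_pred (S k) r -> sm_pred (S k.+1) r) ->
  exists N, forall k, (N <= k)%N -> forall r, sm_pred (S k) r <-> sm_pred (S N) r.
Proof.
move=> S_mono; apply: (noethR (I := fun k => sm_pred (S k))) => //.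
by move=> k; exact: (submod_left_ideal (S k)).
Qed.

(** If no finite list spans, [nxt] picks an element outside the span of each list, and the spans of
    the lists so built form an ascending chain that never becomes stationary. *)
Lemma noetherian_fg (S : submod R^o) : finitely_generated (subm S).
Proof.
pose spans (s : seq (subm S)) := span_lt (nth 0 s) id (size s).
have [[s sS]|nS] := pselect (exists s, forall v, spans s v).
  exists (size s), (fun i => nth 0 s i) => v.
  have [f [fs <-]] := sS v; exists (fun i => coef (i : nat) f).
  rewrite (@fliftE _ _ _ _ _ (iota 0 (size s))) ?iota_uniq //.
    by rewrite -[in LHS](subn0 (size s)) -/(index_iota _ _) big_mkord.
  by move=> i; rewrite mem_iota add0n /=; apply: contraNT; rewrite -leqNgt => /fs ->.
have /choice[nxt nxtP] (s : seq (subm S)) : exists v, ~ spans s v.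
  by apply/not_existsP => h; apply: nS; exists s => v; apply: contrapT; exact: h.
pose t := fix t k := if k is k'.+1 then rcons (t k') (nxt (t k')) else [::].
pose y k := nxt (t k).
have tE k : t k = mkseq y k by elim: k => // k IH; rewrite mkseqS -IH.
have [|N hN] := @submod_acc (fun k => span_submod (fun i => val (y i) : R^o) id k).
  by move=> k r [f [fk fr]]; exists f; split=> // v /ltnW; exact: fk.
have yN1 : span_lt (fun i => val (y i) : R^o) id N.+1 (val (y N)).
  exact: (@span_gen _ _ _ _ id N.+1 N).
have /hN[//|f [fN fy]] := yN1.
exfalso.
apply: (nxtP (t N)); exists f; rewrite tE size_mkseq; split=> //.
rewrite -tE -/(y N); apply: val_inj; rewrite -fy tE.
have f_supp i : coef i f != 0 -> i \in iota 0 N.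
  by rewrite mem_iota add0n /=; apply: contraNT; rewrite -leqNgt => /fN ->.
rewrite !(fliftE _ (iota_uniq 0 N) f_supp) raddf_sum /=.
by apply: eq_big_seq => i; rewrite mem_iota add0n /= => iN; rewrite nth_mkseq.
Qed.

Hypothesis regR : left_regular R.

Lemma ideal_pdle (S : submod R^o) : exists d, pdle d (subm S).
Proof.
have [d pdS] := regR (noetherian_fg S).
by exists d; exact: proj_dim_le_pdle.
Qed.

End Noetherian.

(** * Dickson's lemma and monomial orders *)

Section Dickson.

Lemma increasing_leq (phi : nat -> nat) :
  (forall i, (phi i < phi i.+1)%N) -> forall i, (i <= phi i)%N.
Proof. by move=> phiS; elim=> // i IH; exact: leq_ltn_trans (phiS i). Qed.

Lemma nondecreasing_subsequence (u : nat -> nat) :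
  exists phi : nat -> nat, (forall i, (phi i < phi i.+1)%N) /\
    forall i j, (i <= j)%N -> (u (phi i) <= u (phi j))%N.
Proof.
(* [g m] is a position, from [m] on, where [u] takes its least value on that tail; iterating [g]
   gives the subsequence. *)
have /choice[g gP] m : exists p, (m <= p)%N /\ forall q, (m <= q)%N -> (u p <= u q)%N.
  have ex : exists k, `[< exists2 p, (m <= p)%N & u p = k >].
    by exists (u m); apply/asboolP; exists m.
  case: (ex_minnP ex) => k /asboolP[p mp <-] kmin; exists p; split=> // q mq.
  by apply: kmin; apply/asboolP; exists q.
pose phi := fix phi i := if i is i'.+1 then g (phi i').+1 else g 0%N.
have phiS i : (phi i < phi i.+1)%N by have [] := gP (phi i).+1.
have u_step i : (u (phi i) <= u (phi i.+1))%N.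
  have [m [mi phim]] : exists m, (m <= phi i)%N /\ phi i = g m.
    by case: i => [|i] /=; [exists 0%N|exists (phi i).+1; have [] := gP (phi i).+1].
  have [_ gmin] := gP m; rewrite phim; apply: gmin.
  exact: leq_trans mi (ltnW (phiS i)).
exists phi; split=> // i j.
exact: (@homo_leq _ (u \o phi) (fun k l => k <= l)%N leqnn (fun y x z =>
  @leq_trans y x z) u_step).
Qed.

Lemma increasing_homo_leq (phi : nat -> nat) :
  (forall i, (phi i < phi i.+1)%N) -> {homo phi : i j / (i <= j)%N}.
Proof.
move=> phiS; apply: (@homo_leq _ phi (fun k l => k <= l)%N leqnn) => [y x z|i].
  exact: leq_trans.
exact: ltnW.
Qed.

(** The subsequence is refined one coordinate at a time; a further refinement preserves monotonicity
    in the coordinates already treated. *)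
Lemma dickson_subsequence n (u : nat -> {ffun 'I_n -> nat}) :
  exists phi : nat -> nat, (forall i, (phi i < phi i.+1)%N) /\
    forall i j, (i <= j)%N -> forall l, (u (phi i) l <= u (phi j) l)%N.
Proof.
suff [phi [phiS uphi]] : exists phi : nat -> nat, (forall i, (phi i < phi i.+1)%N) /\
    forall i j, (i <= j)%N -> forall l, l \in enum 'I_n ->
      (u (phi i) l <= u (phi j) l)%N.
  by exists phi; split=> // i j ij l; apply: uphi => //; rewrite mem_enum.
elim: (enum 'I_n) => [|l s [phi [phiS uphi]]]; first by exists id; split.
have [psi [psiS upsi]] := nondecreasing_subsequence (fun i => u (phi i) l).
have phi_lt i j : (i < j)%N -> (phi i < phi j)%N.
  by move=> ij; apply: leq_trans (phiS i) _; exact: increasing_homo_leq ij.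
exists (phi \o psi); split=> [i|i j ij k] /=; first exact/phi_lt/psiS.
rewrite inE => /predU1P[->|ks]; first exact: upsi.
by apply: uphi => //; exact: increasing_homo_leq.
Qed.

End Dickson.

Definition minc n (a : {ffun 'I_n -> nat}) (i : 'I_n) : {ffun 'I_n -> nat} :=
  [ffun j => (a j + (j == i))%N].

Definition mdeg n (a : {ffun 'I_n -> nat}) : nat := (\sum_i a i)%N.

Lemma mdeg_minc n (a : {ffun 'I_n -> nat}) i : mdeg (minc a i) = (mdeg a).+1.
Proof.
rewrite /mdeg (eq_bigr (fun j => a j + (j == i))%N) => [|j _]; last by rewrite ffunE.
rewrite big_split /= -addn1; congr (_ + _)%N.
by rewrite (bigD1 i) //= eqxx big1 // => j /negPf ->.
Qed.

Lemma minc_chain n (P : {ffun 'I_n -> nat} -> Prop) (a b : {ffun 'I_n -> nat}) :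
  (forall c i, P c -> P (minc c i)) -> (forall j, (a j <= b j)%N) -> P a -> P b.
Proof.
move=> Pinc; have [k] := ubnP (mdeg b - mdeg a); elim: k a => // k IH a abk ab Pa.
have [->//|nab] := pselect (b = a).
have [i aib] : exists i, (a i < b i)%N.
  apply: contrapT => /forallNP h; apply: nab; apply/ffunP => i; apply/eqP.
  by rewrite eqn_leq ab andbT leqNgt; apply/negP/h.
have aib' j : (minc a i j <= b j)%N.
  by rewrite ffunE; case: eqP => [->|_]; rewrite ?addn1 ?addn0.
apply: (IH (minc a i)) => //; last exact: Pinc.
have : (mdeg (minc a i) <= mdeg b)%N by apply: leq_sum.
rewrite mdeg_minc; lia.
Qed.

(** * Uniform dimension bound for a monotone family of left ideals *)

Section BoundedIdeals.
Variables (R : pzRingType) (n : nat).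
Hypotheses (noethR : left_noetherian R) (regR : left_regular R).
Variable I : {ffun 'I_n -> nat} -> submod R^o.
Hypothesis I_minc : forall a i r, sm_pred (I a) r -> sm_pred (I (minc a i)) r.

Lemma subm_ext_pdle (M : lmodType R) (S S' : submod M) d :
  (forall v, sm_pred S v <-> sm_pred S' v) -> pdle d (subm S) -> pdle d (subm S').
Proof.
move=> SS'.
have S1 (u : subm S) : sm_pred S' (subm_incl S u) by apply/SS'; exact: subm_in.
have S2 (u : subm S') : sm_pred S (val u) by apply/SS'; exact: subm_in.
apply: (@pdle_iso _ _ _ _ (corestrict S1)).
by exists (fun u => mksubm (S2 u)) => u; apply: val_inj.
Qed.

(** Otherwise pick for each [d] an exponent [u d] whose ideal violates the bound [d]. Along a
    Dickson subsequence these ideals increase, hence become stationary, so one finite bound serves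
    infinitely many of them. *)
Lemma bounded_pdle : exists d, forall a, pdle d (subm (I a)).
Proof.
apply: contrapT => /forallNP unb.
have /choice[u uP] d : exists a, ~ pdle d (subm (I a)) by apply/existsNP/unb.
have [phi [phiS uphi]] := dickson_subsequence u.
have I_mono k r : sm_pred (I (u (phi k))) r -> sm_pred (I (u (phi k.+1))) r.
  apply: (@minc_chain _ (fun a => sm_pred (I a) r)) => [a i|]; first exact: I_minc.
  exact: uphi.
have [N hN] := submod_acc noethR I_mono.
have [d pd] := ideal_pdle noethR regR (I (u (phi N))).
(* This index is past [N], where the ideal is stationary, and [phi] of it is at least [d], so the
   violated bound is at least [d]. *)
apply: (uP (phi (maxn N d))).
apply: (@pdle_leq _ d); first exact: leq_trans (leq_maxr N d) (increasing_leq phiS _).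
apply: subm_ext_pdle pd => r; apply: iff_sym; apply: hN; exact: leq_maxl.
Qed.

End BoundedIdeals.

Section Rank.
Variables (T : choiceType) (lt : T -> T -> Prop).
Hypotheses (lt_irr : forall t, ~ lt t t)
  (lt_trans : forall s t u, lt s t -> lt t u -> lt s u)
  (lt_total : forall s t, s <> t -> lt s t \/ lt t s)
  (lt_fin : forall t, exists s : seq T, forall u, lt u t -> u \in s).

(** The rank of an element is the number of its predecessors. *)
Lemma rank_exists : exists rho : T -> nat,
  injective rho /\ forall s t, lt s t <-> (rho s < rho t)%N.
Proof.
have [init initP] := choice lt_fin.
pose below t := [seq u <- undup (init t) | `[< lt u t >]].
have below_uniq t : uniq (below t) by rewrite filter_uniq ?undup_uniq.
have mem_below t u : (u \in below t) = `[< lt u t >].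
  by rewrite mem_filter mem_undup; case: asboolP => //= /initP.
have mono s t : lt s t -> (size (below s) < size (below t))%N.
  move=> st; apply: (@uniq_leq_size _ (s :: below s)) => [|u].
    by rewrite /= below_uniq mem_below andbT; apply/asboolP/lt_irr.
  rewrite inE !mem_below => /predU1P[->|/asboolP us]; apply/asboolP => //.
  exact: lt_trans us st.
exists (size \o below); split=> [s t|s t].
  move=> st; apply: contrapT => /lt_total[] /mono;
    rewrite -[X in (X < _)%N]/((size \o below) _).
    by rewrite st ltnn.
  by rewrite -st ltnn.
split=> [/mono//|]; apply: contraPP => nst.
have [->|st] := pselect (s = t); first by rewrite ltnn.
have [//|/mono ts] := lt_total st.
by apply/negP; rewrite -leqNgt; exact: ltnW.
Qed.

End Rank.

Section DegLex.
Variables (n b : nat).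
Let Mon := {ffun 'I_n -> nat}.
Implicit Types a c : Mon.

Definition lexlt a c := exists i, (a i < c i)%N /\ forall j : 'I_n, (j < i)%N ->
  a j = c j.

Lemma lexlt_irr a : ~ lexlt a a.
Proof. by case=> i []; rewrite ltnn. Qed.

Lemma lexlt_trans : forall a c e, lexlt a c -> lexlt c e -> lexlt a e.
Proof.
move=> a c e [i [aci eqi]] [j [cej eqj]].
case: (ltngtP i j) => [ij|ji|/ord_inj ij].
- exists i; rewrite -(eqj _ ij); split=> // k ki; rewrite eqi // eqj //;
  exact: ltn_trans ij.
- exists j; rewrite (eqi _ ji); split=> // k kj; rewrite eqi ?eqj //;
  exact: ltn_trans ji.
- subst j; exists i; split=> [|k ki]; first exact: ltn_trans aci cej.
  by rewrite eqi ?eqj.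
Qed.

Lemma lexlt_total a c : a <> c -> lexlt a c \/ lexlt c a.
Proof.
move=> /eqP ac.
have [i0 i0P] : exists i, a i != c i.
  apply/existsP; apply: contraNT ac; rewrite negb_exists => /forallP h.
  by apply/eqP/ffunP => i; apply/eqP; rewrite -[_ == _]negbK.
case: (@arg_minnP _ i0 (fun i => a i != c i) (fun i : 'I_n => i : nat) i0P) =>
  i aci imin.
have eqi (j : 'I_n) : (j < i)%N -> a j = c j.
  by move=> ji; apply/eqP; apply: contraTT ji; rewrite -leqNgt; exact: imin.
case: (ltngtP (a i) (c i)) aci => // ac' _; [left|right]; exists i;
  split=> // j /eqi //.
Qed.

Lemma lexlt_minc a c i : lexlt a c -> lexlt (minc a i) (minc c i).
Proof.
move=> [j [acj eqj]]; exists j; rewrite !ffunE ltn_add2r; split=> // k /eqj.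
by rewrite !ffunE => ->.
Qed.

(** Terms are compared by degree, then lexicographically, then by position of the module generator.
    Putting the degree first makes the initial segments finite. *)
Definition degpos_lt (u v : Mon * 'I_b) :=
  (mdeg u.1 < mdeg v.1)%N \/
  (mdeg u.1 = mdeg v.1 /\ (lexlt u.1 v.1 \/ (u.1 = v.1 /\ (u.2 < v.2)%N))).

Lemma deglex_rank : exists rho : Mon * 'I_b -> nat,
  [/\ injective rho,
      forall u v, (mdeg u.1 < mdeg v.1)%N -> (rho u < rho v)%N
    & forall a c i k l, (rho (a, k) < rho (c, l))%N ->
        (rho (minc a i, k) < rho (minc c i, l))%N].
Proof.
have [||||rho [rho_inj rhoP]] := @rank_exists (Mon * 'I_b)%type degpos_lt.
- move=> u []; first by rewrite ltnn.
  by move=> [_ [/lexlt_irr//|[_]]]; rewrite ltnn.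
- move=> u v w [uv|[uv uv']] [vw|[vw vw']].
  + by left; exact: ltn_trans vw.
  + by left; rewrite -vw.
  + by left; rewrite uv.
  + right; split; first by rewrite uv.
    case: uv' vw' => [uv'|[uv' uv'']] [vw'|[vw' vw'']].
    * by left; exact: lexlt_trans vw'.
    * by left; rewrite -vw'.
    * by left; rewrite uv'.
    * by right; split; [rewrite uv'|exact: ltn_trans vw''].
- move=> [a k] [c l] ne; rewrite /degpos_lt /=.
  case: (ltngtP (mdeg a) (mdeg c)) => [| |mac]; [by left; left|by right; left|].
  have [ac|/lexlt_total[ac|ca]] := pselect (a = c).
  + case: (ltngtP k l) => [kl|lk|/ord_inj kl].
    * by left; right; split=> //; right.
    * by right; right; split=> //; right.
    * by case: ne; rewrite ac kl.
  + by left; right; split=> //; left.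
  + by right; right; split=> //; left.
- move=> [c l].
  (* Every exponent of degree at most [mdeg c] has its entries at most [mdeg c], so this finite list
     covers the predecessors. *)
  exists [seq ([ffun j => val (f j)], k) |
    f : {ffun 'I_n -> 'I_(mdeg c).+1} <- enum {: {ffun 'I_n -> 'I_(mdeg c).+1}},
    k : 'I_b <- enum 'I_b].
  move=> [a k] ac; have amc : (mdeg a <= mdeg c)%N by case: ac => [/ltnW|[->]].
  have ai i : (a i < (mdeg c).+1)%N.
    by rewrite ltnS; apply: leq_trans amc; rewrite /mdeg (bigD1 i) //= leq_addr.
  apply/allpairsP; exists ([ffun i => Ordinal (ai i)], k); rewrite !mem_enum;
    split=> //.
  by congr pair; apply/ffunP => j; rewrite !ffunE.
exists rho; split=> // [u v uv|a c i k l].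
  by apply/rhoP; left.
move=> /rhoP ac; apply/rhoP; move: ac; rewrite /degpos_lt /= !mdeg_minc ltnS.
case=> [ac|[-> ac]]; first by left.
right; split=> //; case: ac => [ac|[-> kl]]; [by left; exact: lexlt_minc|by right].
Qed.

End DegLex.

(** * Leading terms in a skew PBW extension *)

Lemma rmorphism_inverse (R : pzRingType) (f : {rmorphism R -> R}) :
  bijective f -> exists g : {rmorphism R -> R}, cancel f g /\ cancel g f.
Proof.
move=> [g fK gK].
have gB : zmod_morphism g by move=> a b; apply: (can_inj fK); rewrite rmorphB !gK.
have gM : monoid_morphism g.
  by split=> [|a b]; apply: (can_inj fK); rewrite ?rmorphM ?rmorph1 !gK.
pose gr : {rmorphism R -> R} := HB.pack g
  (GRing.isZmodMorphism.Build R R g gB) (GRing.isMonoidMorphism.Build R R g gM).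
by exists gr.
Qed.

Lemma invertible1 (R : pzRingType) : invertible (1 : R).
Proof. by exists 1; rewrite mulr1. Qed.

Lemma invertibleM (R : pzRingType) (a b : R) : invertible a -> invertible b ->
  invertible (a * b).
Proof.
move=> [c [ac ca]] [d [bd db]]; exists (d * c).
by rewrite mulrA -(mulrA a) bd mulr1 ac mulrA -(mulrA d) ca mulr1 db.
Qed.

Lemma invertible_rmorph (R S : pzRingType) (f : {rmorphism R -> S}) (a : R) :
  invertible a -> invertible (f a).
Proof. by move=> [c [ac ca]]; exists (f c); rewrite -!rmorphM ac ca rmorph1. Qed.

Lemma invertible_mul0 (R : pzRingType) (a u : R) : invertible u -> a * u = 0 -> a = 0.
Proof. by move=> [v [uv _]] /(congr1 ( *%R^~ v)); rewrite -mulrA uv mulr1 mul0r. Qed.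

Section Exponents.
Variable n : nat.
Implicit Types a b : {ffun 'I_n -> nat}.

Definition mzero : {ffun 'I_n -> nat} := [ffun => 0%N].

Lemma mdeg0 : mdeg mzero = 0%N.
Proof. by rewrite /mdeg big1 // => i _; rewrite ffunE. Qed.

Lemma minc_inj i : injective ((@minc n)^~ i).
Proof.
by move=> a b /ffunP ab; apply/ffunP => j; have := ab j; rewrite !ffunE => /addIn.
Qed.

Lemma mincC a i j : minc (minc a i) j = minc (minc a j) i.
Proof. by apply/ffunP => k; rewrite !ffunE addnAC. Qed.

Lemma minc_gt0 a i : (0 < minc a i i)%N.
Proof. by rewrite ffunE eqxx addn1. Qed.

Lemma minc_exists a i : (0 < a i)%N -> exists b, a = minc b i.
Proof.
move=> ai; exists [ffun j => (a j - (j == i))%N]; apply/ffunP => j; rewrite !ffunE.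
by case: eqP => [->|_] /=; rewrite ?subnK // subn0 addn0.
Qed.

(** Splits off the smallest variable that occurs. It stands leftmost in the ordered monomial, so by
    [monomial_minc] no commutation is involved; this drives the inductions on the degree. *)
Lemma exponent_min a : a = mzero \/
  exists b j, a = minc b j /\ forall k : 'I_n, (k < j)%N -> a k = 0%N.
Proof.
have [a0|na] := pselect (forall i, a i = 0%N).
  by left; apply/ffunP => i; rewrite a0 ffunE.
right; have /existsNP[i0 /eqP i0P] := na.
case: (@arg_minnP _ i0 (fun i => a i != 0%N) (fun i : 'I_n => i : nat) i0P) => j.
rewrite -lt0n => /minc_exists[b ab] jmin; exists b, j; split=> // k kj.
by apply/eqP; apply: contraTT kj; rewrite -leqNgt; exact: jmin.
Qed.

Section Monomials.
Variables (A : pzRingType) (x : 'I_n -> A).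

Lemma monomial0 : monomial x mzero = 1.
Proof. by rewrite /monomial big1 // => i _; rewrite ffunE expr0. Qed.

Lemma monomial_minc a (i : 'I_n) : (forall j : 'I_n, (j < i)%N -> a j = 0%N) ->
  monomial x (minc a i) = x i * monomial x a.
Proof.
move=> a0; have mE (c : {ffun 'I_n -> nat}) :
  monomial x c = \prod_(j <- enum 'I_n) x j ^+ c j.
  by rewrite /monomial enumT [index_enum _]unlock.
rewrite !mE.
have [s1 [s2 [es us s1i]]] : exists s1 s2, [/\ enum 'I_n = s1 ++ i :: s2,
    uniq (s1 ++ i :: s2) & forall j, j \in s1 -> (j < i)%N].
  have iE : i \in enum 'I_n by rewrite mem_enum.
  exists (take i (enum 'I_n)), (drop i.+1 (enum 'I_n)).
  have es : enum 'I_n = take i (enum 'I_n) ++ i :: drop i.+1 (enum 'I_n).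
    by rewrite -[X in X :: _](nth_ord_enum i i) -drop_nth ?cat_take_drop // size_enum_ord.
  split=> // [|j]; first by rewrite -es enum_uniq.
  move=> /(nthP i)[k]; rewrite size_takel ?size_enum_ord ?(ltnW (ltn_ord i)) // => ki.
  by rewrite nth_take // => <-; rewrite (nth_enum_ord i (ltn_trans ki (ltn_ord i))).
rewrite es !big_cat !big_cons /=.
have s1_1 (c : {ffun 'I_n -> nat}) : (forall j : 'I_n, (j < i)%N -> c j = 0%N) ->
    \prod_(j <- s1) x j ^+ c j = 1.
  by move=> c0; rewrite big_seq big1 // => j /s1i/c0 ->; rewrite expr0.
rewrite !s1_1 // => [|j ji]; last by rewrite ffunE a0 // add0n -val_eqE /= ltn_eqF.
rewrite !mul1r ffunE eqxx addn1 exprS -mulrA; congr (_ * (_ * _)).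
apply: eq_big_seq => j js2; rewrite ffunE.
case: eqP => [ji|_]; last by rewrite addn0.
by move: us; rewrite -ji cat_uniq /= js2 !andbF.
Qed.

End Monomials.
End Exponents.

(** Collects fixed choices: the automorphisms with their inverses, the derivations, and the left
    [R]-linear isomorphism of [A] with the free module on the exponents. *)
Record pbw_data (R A : pzRingType) (iota : {rmorphism R -> A}) (n : nat) (x : 'I_n ->
  A) :=
  PBWData {
  pbw_sigma : 'I_n -> {rmorphism R -> R};
  pbw_sigmaV : 'I_n -> {rmorphism R -> R};
  pbw_sigmaK : forall i, cancel (pbw_sigma i) (pbw_sigmaV i);
  pbw_sigmaVK : forall i, cancel (pbw_sigmaV i) (pbw_sigma i);
  pbw_delta : 'I_n -> R -> R;
  pbw_twist : forall i r,
    x i * iota r = iota (pbw_sigma i r) * x i + iota (pbw_delta i r);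
  pbw_swap : forall i j : 'I_n, (i < j)%N ->
    exists c : R, commutation_coef iota x i j c /\ invertible c;
  pbw_repr : {linear res iota A^o -> free_mod R {ffun 'I_n -> nat}};
  pbw_eval : {linear free_mod R {ffun 'I_n -> nat} -> res iota A^o};
  pbw_evalE : forall a, pbw_eval (delta R a) = monomial x a;
  pbw_reprK : cancel pbw_repr pbw_eval;
  pbw_evalK : cancel pbw_eval pbw_repr }.

Lemma pbw_data_exists (R A : pzRingType) (iota : {rmorphism R -> A}) (n : nat)
  (x : 'I_n -> A) : bijective_skew_PBW iota x -> inhabited (pbw_data iota x).
Proof.
move=> [[_ span free _ _] sig swap].
have /choice[s sP] i : exists s : ({rmorphism R -> R} * {rmorphism R -> R}) * (R -> R),
    [/\ cancel s.1.1 s.1.2, cancel s.1.2 s.1.1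
      & forall r, x i * iota r = iota (s.1.1 r) * x i + iota (s.2 r)].
  have [f [d [[_ _ fd] /rmorphism_inverse[g [fK gK]]]]] := sig i.
  by exists (f, g, d).
pose ev : {linear free_mod R {ffun 'I_n -> nat} -> res iota A^o} :=
  flift (monomial x : _ -> res iota A^o).
have evE f : ev f = \sum_(t <- supp f) iota (coef t f) * monomial x t by [].
have [||rp [evK rpK]] := @lin_inv _ _ _ ev.
- have ev0 f : ev f = 0 -> f = 0.
    rewrite evE => f0; apply: fcoefP => t; apply: contrapT => /eqP ft.
    have := free _ (fun t => coef t f) (supp_uniq f) f0 t (mem_supp ft).
    by move/eqP: ft.
  move=> f g fg; apply/eqP; rewrite -subr_eq0; apply/eqP/ev0.
  by rewrite linearB fg subrr.
- move=> a; have [s' [c ->]] := span a.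
  exists (\sum_(t <- s') c t *: delta R t); rewrite linear_sum; apply: eq_bigr => t _.
  by rewrite linearZ flift_delta.
constructor; apply: (@PBWData _ _ _ _ _ (fun i => (s i).1.1) (fun i => (s i).1.2)
  _ _ (fun i => (s i).2) _ swap rp ev) => //.
- by move=> i; have [] := sP i.
- by move=> i; have [] := sP i.
- by move=> i; have [] := sP i.
- by move=> t; exact: flift_delta.
Qed.

(** * Degree estimates and leading coefficients *)

Section SkewPBWTheory.
Variables (R A : pzRingType) (iota : {rmorphism R -> A}) (n : nat) (x : 'I_n -> A).
Variable D : pbw_data iota x.
Let Mon := {ffun 'I_n -> nat}.
Let sg := pbw_sigma D.
Let dl := pbw_delta D.
Implicit Types (a b : Mon) (p : A).

Definition pcoef a p : R := coef a (pbw_repr D p).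

Lemma pcoef_linear a : linear (pcoef a : res iota A^o -> R^o).
Proof. by move=> r p p'; rewrite /pcoef linearP. Qed.

Lemma pcoefD a p p' : pcoef a (p + p') = pcoef a p + pcoef a p'.
Proof. exact: (linearD (mklin (pcoef_linear a))). Qed.

Lemma pcoefB a p p' : pcoef a (p - p') = pcoef a p - pcoef a p'.
Proof. exact: (linearB (mklin (pcoef_linear a))). Qed.

Lemma pcoef0 a : pcoef a 0 = 0.
Proof. exact: (linear0 (mklin (pcoef_linear a))). Qed.

Lemma pcoefZ a r p : pcoef a (iota r * p) = r * pcoef a p.
Proof. exact: (linearZ_LR (mklin (pcoef_linear a))). Qed.

Lemma pcoef_monomial a b : pcoef a (monomial x b) = (a == b)%:R.
Proof. by rewrite /pcoef -(pbw_evalE D) pbw_evalK coef_delta. Qed.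

Lemma pbw_ind (W : Mon -> Prop) (P : A -> Prop) :
  P 0 -> (forall p p', P p -> P p' -> P (p + p')) ->
  (forall r a, W a -> P (iota r * monomial x a)) ->
  forall p, (forall a, pcoef a p <> 0 -> W a) -> P p.
Proof.
move=> P0 PD Pm p pW; rewrite -[p](pbw_reprK D).
apply: (@free_ind _ _ W (fun f => P (pbw_eval D f))) pW => [|f g Pf Pg|r t Wt].
- by rewrite linear0.
- by rewrite linearD; exact: PD.
- by rewrite linearZ pbw_evalE; exact: Pm.
Qed.

Lemma pcoefP p p' : (forall a, pcoef a p = pcoef a p') -> p = p'.
Proof.
move=> e; rewrite -[p](pbw_reprK D) -[p'](pbw_reprK D).
by congr (pbw_eval D _); apply: fcoefP.
Qed.

Definition deglt k p := forall a, (k <= mdeg a)%N -> pcoef a p = 0.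

Lemma deglt_W k p a : deglt k p -> pcoef a p <> 0 -> (mdeg a < k)%N.
Proof. by move=> pk; rewrite ltnNge => pa; apply/negP => /pk. Qed.

Lemma deglt_ind k (P : A -> Prop) :
  P 0 -> (forall p p', P p -> P p' -> P (p + p')) ->
  (forall r a, (mdeg a < k)%N -> P (iota r * monomial x a)) ->
  forall p, deglt k p -> P p.
Proof.
move=> P0 PD Pm p pk.
by apply: (@pbw_ind (fun a => (mdeg a < k)%N)) => // a; exact: deglt_W.
Qed.

Lemma deglt0 k : deglt k 0. Proof. by move=> a _; rewrite pcoef0. Qed.

Lemma degltD k p p' : deglt k p -> deglt k p' -> deglt k (p + p').
Proof. by move=> pk pk' a ka; rewrite pcoefD pk ?pk' ?addr0. Qed.

Lemma degltZ k r p : deglt k p -> deglt k (iota r * p).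
Proof. by move=> pk a ka; rewrite pcoefZ pk ?mulr0. Qed.

Lemma deglt_leq j k p : (j <= k)%N -> deglt j p -> deglt k p.
Proof. by move=> jk pj a ka; apply: pj; exact: leq_trans ka. Qed.

Lemma deglt_monomial k a : (mdeg a < k)%N -> deglt k (monomial x a).
Proof.
by move=> ak b kb; rewrite pcoef_monomial; case: eqP => // ba;
  rewrite ba leqNgt ak in kb.
Qed.

Lemma deglt_sum k (I : Type) (s : seq I) (F : I -> A) :
  (forall i, deglt k (F i)) -> deglt k (\sum_(i <- s) F i).
Proof. by move=> Fk; apply: big_ind => //; [exact: deglt0|exact: degltD]. Qed.

Lemma mul_x_term i r p :
  x i * (iota r * p) = iota (sg i r) * (x i * p) + iota (dl i r) * p.
Proof. by rewrite mulrA (pbw_twist D) mulrDl !mulrA. Qed.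

(** The remainder has degree at most [mdeg a], below that of the leading monomial. Naming the
    property allows [deglt_mul_x_of_shifts] to be applied inside the induction that proves it. *)
Definition shifts_at i a := exists u, invertible u /\
  deglt (mdeg a).+1 (x i * monomial x a - iota u * monomial x (minc a i)).

Lemma deglt_mul_x_of_shifts k i p :
  (forall a, (mdeg a < k)%N -> shifts_at i a) -> deglt k p -> deglt k.+1 (x i * p).
Proof.
move=> sh; move: p; apply: deglt_ind => [|p p' IHp IHp'|r a ak].
- by rewrite mulr0; exact: deglt0.
- by rewrite mulrDr; exact: degltD.
have [u [_ xa]] := sh a ak.
rewrite mul_x_term -[x i * _](subrK (iota u * monomial x (minc a i))).
apply: degltD; apply: degltZ; last exact/deglt_monomial/ltnW.
apply: degltD; first by apply: deglt_leq xa; exact: ltnW.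
by apply: degltZ; apply: deglt_monomial; rewrite mdeg_minc.
Qed.

(** If no variable before [x_i] occurs, the product is already ordered. Otherwise write
    [x^a = x_j x^b] with [j < i], exchange [x_i] and [x_j], and apply induction to [x_i x^b]; the
    terms of the exchange relation have lower degree. *)
Lemma x_monomial i a : shifts_at i a.
Proof.
have [k] := ubnP (mdeg a); elim: k a i => // k IH a i ak.
have [ai0|] := pselect (forall j : 'I_n, (j < i)%N -> a j = 0%N).
  exists 1; split; first exact: invertible1.
  by rewrite rmorph1 mul1r monomial_minc // subrr; exact: deglt0.
case: (exponent_min a) => [->|[b [j [ab a0]]]].
  by case=> j _; rewrite ffunE.
move=> nai; have ji : (j < i)%N.
  by rewrite ltnNge; apply/negP => ij; apply: nai => l li; apply: a0;
    exact: leq_trans ij.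
have b0 (l : 'I_n) : (l < j)%N -> b l = 0%N.
  by move=> /a0; rewrite ab ffunE; lia.
have bk : (mdeg b < k)%N by move: ak; rewrite ab mdeg_minc.
have mb : mdeg a = (mdeg b).+1 by rewrite ab mdeg_minc.
have [u [u_inv xib]] := IH b i bk.
have [c [[r0 [r xji]] c_inv]] := pbw_swap D ji.
(* [c] comes from exchanging [x_i] and [x_j], and [sg j u] from moving the coefficient [u] of the
   inductive case across [x_j]. *)
exists (c * sg j u); split; first by apply: invertibleM => //; exact: invertible_rmorph.
have mono_a : monomial x a = x j * monomial x b by rewrite ab monomial_minc.
have mono_ai : monomial x (minc a i) = x j * monomial x (minc b i).
  rewrite ab mincC monomial_minc // => l lj.
  by rewrite ffunE b0 // -val_eqE /= ltn_eqF // (ltn_trans lj ji).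
have low (l : 'I_n) (p : A) : deglt (mdeg b).+1 p -> deglt (mdeg a).+1 (x l * p).
  rewrite mb; apply: deglt_mul_x_of_shifts => e; rewrite ltnS => eb.
  by apply: IH; exact: leq_ltn_trans bk.
have e1 : x i * monomial x a = iota c * (x j * (x i * monomial x b)) +
    (iota r0 * monomial x b + \sum_(l < n) iota (r l) * (x l * monomial x b)).
  rewrite mono_a mulrA -[x i * x j](subrK (iota c * x j * x i)) xji addrC mulrDl.
  rewrite !mulrA; congr (_ + _); rewrite mulrDl mulr_suml; congr (_ + _).
  by apply: eq_bigr => l _; rewrite mulrA.
pose q := x i * monomial x b - iota u * monomial x (minc b i).
have e2 : x j * (x i * monomial x b) = iota (sg j u) * monomial x (minc a i) +
    iota (dl j u) * monomial x (minc b i) + x j * q.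
  rewrite -[x i * monomial x b](subrK (iota u * monomial x (minc b i))) -/q mulrDr.
  by rewrite addrC mul_x_term mono_ai.
rewrite -/q in xib; clearbody q.
rewrite e1 e2 rmorphM -mulrA !mulrDr.
set t := iota c * (iota (sg j u) * _).
rewrite [X in deglt _ X](_ : _ = iota c * (iota (dl j u) * monomial x (minc b i)) +
  iota c * (x j * q) + (iota r0 * monomial x b +
  \sum_(l < n) iota (r l) * (x l * monomial x b))); last first.
  by rewrite -!addrA [t + _]addrC -!addrA addNr addr0.
have mbb : deglt (mdeg b).+1 (monomial x b) by exact: deglt_monomial.
apply: degltD; [apply: degltD|apply: degltD].
- by do 2!apply: degltZ; apply: deglt_monomial; rewrite mdeg_minc mb.
- by apply: degltZ; apply: low.
- by apply: degltZ; apply: deglt_leq mbb; rewrite mb.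
- by apply: deglt_sum => l; apply: degltZ; exact: low.
Qed.

Lemma deglt_mul_x k i p : deglt k p -> deglt k.+1 (x i * p).
Proof. by apply: deglt_mul_x_of_shifts => a _; exact: x_monomial. Qed.

Lemma leading_coef_exists : exists u : 'I_n -> Mon -> R, forall i a,
  invertible (u i a) /\
  deglt (mdeg a).+1 (x i * monomial x a - iota (u i a) * monomial x (minc a i)).
Proof.
have /choice[u uP] (ia : 'I_n * Mon) : exists u, invertible u /\ deglt (mdeg ia.2).+1
    (x ia.1 * monomial x ia.2 - iota u * monomial x (minc ia.2 ia.1)).
  exact: x_monomial.
by exists (fun i a => u (i, a)) => i a; exact: (uP (i, a)).
Qed.

Definition lcu : 'I_n -> Mon -> R := sval (cid leading_coef_exists).

Lemma lcu_inv i a : invertible (lcu i a).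
Proof. by case: (svalP (cid leading_coef_exists) i a). Qed.

Lemma x_monomialE i a :
  deglt (mdeg a).+1 (x i * monomial x a - iota (lcu i a) * monomial x (minc a i)).
Proof. by case: (svalP (cid leading_coef_exists) i a). Qed.

Lemma pcoef_x_term i r a b : (mdeg a < mdeg b)%N ->
  pcoef b (x i * (iota r * monomial x a)) = sg i r * lcu i a * (b == minc a i)%:R.
Proof.
move=> ab; rewrite mul_x_term pcoefD !pcoefZ pcoef_monomial.
have -> : (b == a) = false by apply: contraTF ab => /eqP ->; rewrite ltnn.
rewrite mulr0 addr0 -[x i * _](subrK (iota (lcu i a) * monomial x (minc a i))).
by rewrite pcoefD x_monomialE // add0r pcoefZ pcoef_monomial mulrA.
Qed.

Lemma pcoef_x_minc i p b : deglt (mdeg b).+1 p ->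
  pcoef (minc b i) (x i * p) = sg i (pcoef b p) * lcu i b.
Proof.
move: p; apply: deglt_ind => [|p p' IHp IHp'|r a ab].
- by rewrite mulr0 !pcoef0 rmorph0 mul0r.
- by rewrite mulrDr !pcoefD IHp IHp' rmorphD mulrDl.
rewrite pcoef_x_term ?mdeg_minc // pcoefZ pcoef_monomial (inj_eq (@minc_inj n i)).
by case: eqP => [->|_]; rewrite ?mulr1 // !mulr0 rmorph0 mul0r.
Qed.

(** In degree [mdeg b] the product contains only shifted exponents [minc a i], which are positive at
    [i]. *)
Lemma pcoef_x_0 i p b : b i = 0%N -> deglt (mdeg b) p -> pcoef b (x i * p) = 0.
Proof.
move=> bi; move: p; apply: deglt_ind => [|p p' IHp IHp'|r a ab].
- by rewrite mulr0 pcoef0.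
- by rewrite mulrDr pcoefD IHp IHp' addr0.
rewrite pcoef_x_term //; case: eqP => [ba|_]; last by rewrite mulr0.
by have := minc_gt0 a i; rewrite -ba bi.
Qed.

(** The automorphism is the composite of the [sg j] along the factors of the monomial; each
    application of a derivation loses a variable and goes into the remainder. *)
Lemma monomial_scalar a : exists (f g : {rmorphism R -> R}),
  [/\ cancel f g, cancel g f
    & forall r, deglt (mdeg a) (monomial x a * iota r - iota (f r) * monomial x a)].
Proof.
have [k] := ubnP (mdeg a); elim: k a => // k IH a ak.
case: (exponent_min a) => [->|[b [j [ab a0]]]].
  exists idfun, idfun; split=> // r.
  by rewrite monomial0 mul1r mulr1 subrr; exact: deglt0.
have b0 (l : 'I_n) : (l < j)%N -> b l = 0%N.
  by move=> /a0; rewrite ab ffunE; lia.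
have [|f [g [fK gK fP]]] := IH b; first by move: ak; rewrite ab mdeg_minc.
exists [the {rmorphism R -> R} of sg j \o f], [the {rmorphism R ->
  R} of g \o pbw_sigmaV D j].
split=> [r|r|r] /=; first by rewrite pbw_sigmaK fK.
  by rewrite gK pbw_sigmaVK.
rewrite ab monomial_minc // mdeg_minc -mulrA.
rewrite -[monomial x b * iota r](subrK (iota (f r) * monomial x b)) mulrDr mul_x_term.
rewrite /= [iota (sg _ _) * _ + _]addrC addrA addrK.
apply: degltD; first exact: deglt_mul_x.
by apply: degltZ; exact: deglt_monomial.
Qed.

Lemma deglt_mul_iota k p r : deglt k p -> deglt k (p * iota r).
Proof.
move: p; apply: deglt_ind => [|p p' IHp IHp'|s a ak].
- by rewrite mul0r; exact: deglt0.
- by rewrite mulrDl; exact: degltD.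
have [f [_ [_ _ fP]]] := monomial_scalar a.
rewrite -mulrA; apply: degltZ.
rewrite -[_ * _](subrK (iota (f r) * monomial x a)); apply: degltD.
  by apply: deglt_leq (fP r); exact: ltnW.
by apply: degltZ; exact: deglt_monomial.
Qed.

End SkewPBWTheory.

(** * Finitely generated modules as modules over the base ring *)

Section FiniteDimensionOverBase.
Variables (R A : pzRingType) (iota : {rmorphism R -> A}) (n : nat) (x : 'I_n -> A).
Variable D : pbw_data iota x.
Hypotheses (noethR : left_noetherian R) (regR : left_regular R).
Variables (M : lmodType A) (b : nat) (e : 'I_b -> M).
Hypothesis e_span : forall v : M, exists c : 'I_b -> A, v = \sum_(i < b) c i *: e i.

Let Mon := {ffun 'I_n -> nat}.
Let W : choiceType := (Mon * 'I_b)%type.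
Variable rho : W -> nat.
Hypotheses (rho_inj : injective rho)
  (rho_deg : forall u v : W, (mdeg u.1 < mdeg v.1)%N -> (rho u < rho v)%N)
  (rho_minc : forall (a c : Mon) i k l, (rho (a, k) < rho (c, l))%N ->
     (rho (minc a i, k) < rho (minc c i, l))%N).

Definition gen (w : W) : res iota M := monomial x w.1 *: e w.2.

Lemma genE r a j : (iota r * monomial x a) *: e j = r *: gen (a, j).
Proof. by rewrite -scalerA. Qed.

Lemma gen_surj : surjective_map (flift gen).
Proof.
have gen_mul p j : exists f, flift gen f = p *: e j.
  apply: (@pbw_ind _ _ _ _ _ D xpredT (fun p => exists f, flift gen f = p *: e j))
    => // [|q q' [f fp] [f' fp']|r a _].
  - by exists 0; rewrite linear0 scale0r.
  - by exists (f + f'); rewrite scalerDl linearD fp fp'.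
  - by exists (r *: delta R (a, j)); rewrite linearZ flift_delta genE.
move=> v; have [c ->] := e_span v.
have /choice[f fP] j : exists f, flift gen f = c j *: e j by exact: gen_mul.
by exists (\sum_(j < b) f j); rewrite linear_sum; apply: eq_bigr.
Qed.

Notation below w := (span_submod gen rho (rho w)).

Lemma low_below k p a j l : deglt D k p -> (k <= mdeg a)%N -> sm_pred (below (a,
  l)) (p *: e j).
Proof.
move=> pk ka; move: p pk; apply: deglt_ind => [|p p' IHp IHp'|r c ck].
- by rewrite scale0r; exact: sm0.
- by rewrite scalerDl; exact: smD.
rewrite genE; apply: smZ; apply: span_gen; apply: rho_deg; exact: leq_trans ka.
Qed.

Lemma rho_mdeg a c k l : (rho (a, k) < rho (c, l))%N -> (mdeg a <= mdeg c)%N.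
Proof.
by move=> ac; rewrite leqNgt; apply/negP => /(@rho_deg (c, l) (a, k));
  rewrite ltnNge ltnW.
Qed.

(** The leading term of [x_i] times a term is its shift, and shifts preserve the order; the other
    terms have degree less than [mdeg (minc a i)], hence smaller rank. *)
Lemma below_mul_x i a j (v : res iota M) :
  sm_pred (below (a, j)) v -> sm_pred (below (minc a i, j)) (x i *: (v : M)).
Proof.
move=> [f [fa <-]].
apply: (@free_ind _ _ (fun w => (rho w < rho (a, j))%N)
  (fun f => sm_pred (below (minc a i, j)) (x i *: (flift gen f : M)))) =>
    [|g h Pg Ph|r|w].
- by rewrite linear0 scaler0; exact: sm0.
- by rewrite linearD scalerDr; exact: smD.
- move=> [c l] cl; rewrite linearZ flift_delta.
  change (sm_pred (below (minc a i, j)) (x i *: (iota r *: (monomial x c *: e l)))).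
  rewrite !scalerA -mulrA (mul_x_term D).
  have ca := rho_mdeg cl.
  rewrite scalerDl; apply: smD.
    rewrite -scalerA; apply: (smZ (S := below (minc a i, j))).
    rewrite -[x i * _](subrK (iota (lcu D i c) * monomial x (minc c i))) scalerDl.
    apply: smD.
      by apply: (@low_below (mdeg c).+1); [exact: x_monomialE|rewrite mdeg_minc].
    by rewrite genE; apply: smZ; apply: span_gen; exact: rho_minc.
  apply: (@low_below (mdeg c).+1); last by rewrite mdeg_minc.
  by apply: degltZ; exact: deglt_monomial.
- by rewrite ltnNge => fw; apply/negP => /fa.
Qed.

Definition rcoef_ideal_pred j a (r : R^o) : Prop :=
  sm_pred (below (a, j)) ((monomial x a * iota r) *: e j).

Lemma rcoef_ideal0 j a : rcoef_ideal_pred j a 0.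
Proof. by rewrite /rcoef_ideal_pred rmorph0 mulr0 scale0r; exact: sm0. Qed.

Lemma rcoef_idealP j a r s t :
  rcoef_ideal_pred j a s -> rcoef_ideal_pred j a t -> rcoef_ideal_pred j a (r *: s + t).
Proof.
rewrite /rcoef_ideal_pred => Is It.
rewrite rmorphD mulrDr scalerDl; apply: smD => //.
have [f [_ [_ _ fP]]] := monomial_scalar D a.
have -> : iota (r *: s) = iota r * iota s by exact: rmorphM.
rewrite mulrA -[monomial x a * iota r](subrK (iota (f r) * monomial x a)) mulrDl scalerDl.
apply: smD; last by rewrite -mulrA -scalerA; exact: (smZ (f r) Is).
by apply: low_below; [apply: deglt_mul_iota; exact: fP|].
Qed.

(* Leading coefficients are taken on the right of the monomials, because in this
   form the left ideals grow with the exponent. *)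
Definition rcoef_ideal j a := Submod (@rcoef_ideal0 j a) (@rcoef_idealP j a).

(** Multiply the membership on the left by [x_i] and by the inverse of the leading coefficient. The
    scalar [r], standing on the right, is not touched. *)
Lemma rcoef_ideal_minc j a i r :
  sm_pred (rcoef_ideal j a) r -> sm_pred (rcoef_ideal j (minc a i)) r.
Proof.
rewrite /= /rcoef_ideal_pred => Ir.
have [v [_ vu]] := lcu_inv D i a.
have -> : monomial x (minc a i) = iota v *
    (x i * monomial x a - (x i * monomial x a - iota (lcu D i a) * monomial x (minc a i))).
  by rewrite subKr mulrA -rmorphM vu rmorph1 mul1r.
rewrite -mulrA -scalerA; apply: (smZ (S := below (minc a i, j))).
rewrite mulrBl scalerBl; apply: smB.
  by rewrite -mulrA -scalerA; exact: below_mul_x.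
apply: (@low_below (mdeg a).+1); last by rewrite mdeg_minc.
by apply: deglt_mul_iota; exact: x_monomialE.
Qed.

(** Moving the scalar across the monomial applies the automorphism [f] up to terms of lower degree,
    so [f] maps one ideal onto the other. It becomes linear once the source is twisted by [g], the
    inverse of [f]. *)
Lemma rcoef_ideal_lead d j a :
  pdle d (subm (rcoef_ideal j a)) -> pdle d (subm (lead_ideal gen rho (a, j))).
Proof.
have [f [g [fK gK fP]]] := monomial_scalar D a.
have If s : sm_pred (rcoef_ideal j a) s <-> sm_pred (lead_ideal gen rho (a, j)) (f s).
  have fs : sm_pred (below (a, j))
      ((monomial x a * iota s - iota (f s) * monomial x a) *: e j).
    by apply: low_below (fP s) _.
  rewrite scalerBl genE in fs.
  split=> Is; rewrite /= in Is *.
    by have := smB (S := below (a, j)) Is fs; rewrite subKr.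
  by have := smD (S := below (a, j)) fs Is; rewrite subrK.
move=> pdI.
have Sf (u : res g (subm (rcoef_ideal j a))) :
    sm_pred (lead_ideal gen rho (a, j)) (f (val (u : subm (rcoef_ideal j a)))).
  by apply/If; exact: subm_in.
have f_lin : linear (fun u => mksubm (Sf u)).
  move=> r u v; apply: val_inj => /=.
  change (f (g r * sval_m u + sval_m v) = r * f (sval_m u) + f (sval_m v)).
  by rewrite rmorphD rmorphM gK.
apply: (@pdle_iso _ _ _ _ (mklin f_lin)); last exact: pdle_twist pdI.
have Sg (u : subm (lead_ideal gen rho (a, j))) : sm_pred (rcoef_ideal j a) (g (val u)).
  by apply/If; rewrite gK; exact: subm_in.
exists (fun u => mksubm (Sg u)) => u; apply: val_inj => /=; [exact: fK|exact: gK].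
Qed.

Lemma res_pdle_rho : exists d, pdle d (res iota M).
Proof.
have /choice[d dP] j : exists d, forall a, pdle d (subm (rcoef_ideal j a)).
  by apply: (bounded_pdle noethR regR) => a i r; exact: rcoef_ideal_minc.
exists (\max_j d j).+1; apply: (chain_pdle rho_inj gen_surj) => -[a j].
by apply: rcoef_ideal_lead; apply: (pdle_leq _ (dP j a)); exact: leq_bigmax.
Qed.

End FiniteDimensionOverBase.

Lemma finitely_generated_res_pdle (R A : pzRingType) (iota : {rmorphism R -> A})
    (n : nat) (x : 'I_n -> A) (M : lmodType A) :
  pbw_data iota x -> left_noetherian R -> left_regular R ->
  finitely_generated M -> exists d, pdle d (res iota M).
Proof.
move=> D noethR regR [b [e e_span]].
have [rho [rho_inj rho_deg rho_minc]] := deglex_rank n b.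
exact: (res_pdle_rho D noethR regR e_span rho_inj rho_deg rho_minc).
Qed.

(** * Syzygies of Pommaret bases *)

Section FreeCoefficients.
Variables (R A : pzRingType) (iota : {rmorphism R -> A}) (n : nat) (x : 'I_n -> A).
Variable D : pbw_data iota x.
Let Mon := {ffun 'I_n -> nat}.
Variables (G : choiceType) (dg : G -> nat).
Let F : lmodType A := free_mod A G.
Implicit Types (a b c : Mon) (g h : G) (f : F).

Definition cf a g f : R := pcoef D a (coef g f).

Lemma cfD a g f f' : cf a g (f + f') = cf a g f + cf a g f'.
Proof. by rewrite /cf fcoefD pcoefD. Qed.

Lemma cfB a g f f' : cf a g (f - f') = cf a g f - cf a g f'.
Proof. by rewrite /cf -pcoefB. Qed.

Lemma cf0 a g : cf a g 0 = 0.
Proof. by rewrite /cf fcoef0 pcoef0. Qed.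

Lemma cfZ a g r f : cf a g (iota r *: f) = r * cf a g f.
Proof. by rewrite /cf fcoefZ pcoefZ. Qed.

Lemma cf_term a g b h : cf a g (monomial x b *: delta A h) = ((a == b) && (g == h))%:R.
Proof.
rewrite /cf fcoefZ coef_delta; case: (g == h); rewrite ?mulr1 ?mulr0.
  by rewrite pcoef_monomial andbT.
by rewrite pcoef0 andbF.
Qed.

Lemma cf_eq0 f : (forall a g, cf a g f = 0) -> f = 0.
Proof.
move=> f0; apply: fcoefP => g; apply: (@pcoefP _ _ _ _ _ D) => a.
by rewrite fcoef0 pcoef0; exact: f0.
Qed.

Lemma cf_ind (W : Mon -> G -> Prop) (P : F -> Prop) :
  P 0 -> (forall f f', P f -> P f' -> P (f + f')) ->
  (forall r a g, W a g -> P (iota r *: (monomial x a *: delta A g))) ->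
  forall f, (forall a g, cf a g f <> 0 -> W a g) -> P f.
Proof.
move=> P0 PD Pm f fW; rewrite (free_expand (supp_uniq f) (@mem_supp _ _ f)).
apply: (big_ind P) => // g _.
apply: (@pbw_ind _ _ _ _ _ D (W^~ g) (fun p => P (p *: delta A g))) =>
  [|p p' Pp Pp'|r a Wa|a].
- by rewrite scale0r.
- by rewrite scalerDl; exact: PD.
- by rewrite -scalerA; exact: Pm.
- exact: fW.
Qed.

Lemma cf_support f : exists s : seq (Mon * G), forall a g, cf a g f <> 0 -> (a,
  g) \in s.
Proof.
apply: (@cf_ind (fun _ _ => True)
  (fun f => exists s : seq (Mon * G), forall a g, cf a g f <> 0 -> (a, g) \in s)) =>
  // [|u v [s us] [s' vs]|r b h _].
- by exists [::] => a g; rewrite cf0.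
- exists (s ++ s') => a g; rewrite cfD mem_cat.
  have [u0|/us ->//] := pselect (cf a g u = 0).
  by rewrite u0 add0r => /vs ->; rewrite orbT.
- exists [:: (b, h)] => a g; rewrite cfZ cf_term inE xpair_eqE.
  by case: (_ && _); rewrite ?mulr0.
Qed.

Definition fdeglt k f := forall a g, cf a g f <> 0 -> (mdeg a + dg g < k)%N.

Lemma fdeglt0 k : fdeglt k 0.
Proof. by move=> a g; rewrite cf0. Qed.

Lemma fdegltD k f f' : fdeglt k f -> fdeglt k f' -> fdeglt k (f + f').
Proof.
move=> fk fk' a g; rewrite cfD.
have [u0|/fk//] := pselect (cf a g f = 0).
by rewrite u0 add0r; exact: fk'.
Qed.

Lemma fdegltZ k r f : fdeglt k f -> fdeglt k (iota r *: f).
Proof.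
move=> fk a g; rewrite cfZ; have [->|/fk//] := pselect (cf a g f = 0).
by rewrite mulr0.
Qed.

Lemma fdegltN k f : fdeglt k f -> fdeglt k (- f).
Proof. by move=> fk; rewrite -scaleN1r -(rmorph1 iota) -rmorphN; exact: fdegltZ. Qed.

Lemma fdeglt_leq j k f : (j <= k)%N -> fdeglt j f -> fdeglt k f.
Proof. by move=> jk fj a g /fj aj; exact: leq_trans jk. Qed.

Lemma fdeglt_term k a g : (mdeg a + dg g < k)%N -> fdeglt k (monomial x a *: delta A g).
Proof.
by move=> ak b h; rewrite cf_term; case: eqP => // ->; case: eqP => // ->.
Qed.

Lemma fdeglt_exists f : exists k, fdeglt k f.
Proof.
have [s fs] := cf_support f.
exists (\max_(u <- s) (mdeg u.1 + dg u.2)).+1 => a g /fs ags.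
by rewrite ltnS (big_rem _ ags) /= leq_maxl.
Qed.

Lemma fdeglt_coef k f g : fdeglt k f -> deglt D (k - dg g) (coef g f).
Proof.
move=> fk a ka; apply: contrapT => /fk; lia.
Qed.

Lemma fdeglt_mul_x k i f : fdeglt k f -> fdeglt k.+1 (x i *: f).
Proof.
move=> fk a g; rewrite /cf fcoefZ => nz; rewrite ltnNge; apply/negP => ka; apply: nz.
have [gk|kg] := leqP (dg g) k.
  by apply: (deglt_mul_x i (fdeglt_coef (g := g) fk)); lia.
have -> : coef g f = 0.
  apply: (@pcoefP _ _ _ _ _ D) => b; rewrite pcoef0.
  by apply: (fdeglt_coef (g := g) fk); lia.
by rewrite mulr0 pcoef0.
Qed.

Lemma cf_x_minc i a g f : fdeglt (mdeg a + dg g).+1 f ->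
  cf (minc a i) g (x i *: f) = pbw_sigma D i (cf a g f) * lcu D i a.
Proof.
move=> /(fdeglt_coef (g := g)) fk; rewrite /cf fcoefZ pcoef_x_minc //.
by apply: deglt_leq fk; lia.
Qed.

Lemma cf_x_0 i a g f : a i = 0%N -> fdeglt (mdeg a + dg g) f -> cf a g (x i *: f) = 0.
Proof.
move=> ai /(fdeglt_coef (g := g)) fk; rewrite /cf fcoefZ pcoef_x_0 //.
by apply: deglt_leq fk; lia.
Qed.

End FreeCoefficients.

Definition zero_below n (k : nat) (a : {ffun 'I_n -> nat}) :=
  forall i : 'I_n, (i < k)%N -> a i = 0%N.

Lemma zero_below_minc n k (a : {ffun 'I_n -> nat}) (i : 'I_n) :
  zero_below k (minc a i) <-> zero_below k a /\ (k <= i)%N.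
Proof.
split=> [ak|[ak ki] j jk]; last first.
  by rewrite ffunE ak // -val_eqE /= ltn_eqF // (leq_trans jk ki).
split=> [j /ak|]; first by rewrite ffunE; lia.
by rewrite leqNgt; apply/negP => /ak; have := minc_gt0 a i; lia.
Qed.

Lemma zero_below_leq n j k (a : {ffun 'I_n -> nat}) :
  (j <= k)%N -> zero_below k a -> zero_below j a.
Proof. by move=> jk ak i ij; apply: ak; exact: leq_trans jk. Qed.

(** The variable added is the smallest one of the resulting exponent, so it can be read off. Hence
    distinct standard terms of the syzygy module have distinct leading terms. *)
Lemma minc_min_inj n (a b : {ffun 'I_n -> nat}) (i j : 'I_n) :
  zero_below i a -> zero_below j b -> minc a i = minc b j -> a = b /\ i = j.
Proof.
move=> ai bj e.
have ij : i = j.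
  have /zero_below_minc[_ ij] : zero_below i (minc b j) by rewrite -e;
    apply/zero_below_minc.
  have /zero_below_minc[_ ji] : zero_below j (minc a i) by rewrite e;
    apply/zero_below_minc.
  by apply: ord_inj; apply/eqP; rewrite eqn_leq ij ji.
by split=> //; move: e; rewrite ij => /minc_inj.
Qed.

Section Pommaret.
Variables (R A : pzRingType) (iota : {rmorphism R -> A}) (n : nat) (x : 'I_n -> A).
Variable D : pbw_data iota x.
Let Mon := {ffun 'I_n -> nat}.

(* [cl g] encodes the multiplicative variables of the generator [g], as in a
   Pommaret basis: the [x_i] with [cl g <= i]. *)
Definition standard (G : choiceType) (cl : G -> nat) (f : free_mod A G) :=
  forall a g, cf D a g f <> 0 -> zero_below (cl g) a.

(** The first two fields say that the standard terms form an [R]-basis of [M]. The class condition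
    on the top-degree terms of [t] keeps them standard under multiplication by the multiplicative
    variables of the syzygy. *)
Record pommaret_basis (G : choiceType) (cl dg : G -> nat) (M : lmodType A)
    (p : {linear free_mod A G -> M}) : Prop := PommaretBasis {
  pom_surj : forall m, exists f, standard cl f /\ p f = m;
  pom_inj : forall f, standard cl f -> p f = 0 -> f = 0;
  pom_rewrite : forall g (j : 'I_n), (j < cl g)%N ->
    exists t, [/\ standard cl t, p (x j *: delta A g - t) = 0
      & forall a h, cf D a h t <> 0 -> (mdeg a + dg h <= (dg g).+1)%N /\
          ((mdeg a + dg h = (dg g).+1)%N -> (cl h <= j)%N)] }.

Section Syzygy.
Variables (G : choiceType) (cl dg : G -> nat) (M : lmodType A).
Variable p : {linear free_mod A G -> M}.
Hypothesis pom : pommaret_basis cl dg p.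

Definition syz_gen : choiceType := {u : G * 'I_n | (u.2 < cl u.1)%N}.
Definition syz_cl (u : syz_gen) : nat := (val u).2.
Definition syz_dg (u : syz_gen) : nat := (dg (val u).1).+1.

Lemma syz_tail_exists : exists t : syz_gen -> free_mod A G, forall u : syz_gen,
  [/\ standard cl (t u), p (x (val u).2 *: delta A (val u).1 - t u) = 0
    & forall a h, cf D a h (t u) <> 0 -> (mdeg a + dg h <= (dg (val u).1).+1)%N /\
        ((mdeg a + dg h = (dg (val u).1).+1)%N -> (cl h <= (val u).2)%N)].
Proof.
have h (u : syz_gen) := pom_rewrite pom (valP u).
by exists (fun u => sval (cid (h u))) => u; exact: svalP (cid (h u)).
Qed.

Definition syz_tail : syz_gen -> free_mod A G := sval (cid syz_tail_exists).

Definition syz_elt (u : syz_gen) : free_mod A G :=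
  x (val u).2 *: delta A (val u).1 - syz_tail u.

Lemma syz_elt_ker u : sm_pred (ker p) (syz_elt u).
Proof. by case: (svalP (cid syz_tail_exists) u). Qed.

Definition syz_map : {linear free_mod A syz_gen -> subm (ker p)} :=
  flift (fun u => mksubm (syz_elt_ker u)).

Definition syz_val : {linear free_mod A syz_gen -> free_mod A G} :=
  lincomp (subm_incl (ker p)) syz_map.

Lemma syz_val_delta u : syz_val (delta A u) = syz_elt u.
Proof.
by rewrite -[LHS]/(val (syz_map (delta A u))) /syz_map flift_delta.
Qed.

Lemma syz_val_term r a u : syz_val (iota r *: (monomial x a *: delta A u)) =
  iota r *: (monomial x a *: syz_elt u).
Proof. by rewrite !linearZ syz_val_delta. Qed.

(* Since every [h] occurring in the top degree of [t] has class at most [j], the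
   variables of [x^a] are multiplicative for it; so apart from [x^(a + e_j) e_g],
   which is not standard, the top degree part of [x^a (x_j e_g - t)] is standard. *)
Lemma syz_lead (a : Mon) (u : syz_gen) : zero_below (syz_cl u) a ->
  exists w, [/\ invertible w,
    fdeglt D dg (mdeg a + syz_dg u).+1 (monomial x a *: syz_elt u),
    cf D (minc a (val u).2) (val u).1 (monomial x a *: syz_elt u) = w
    & forall c h, (mdeg c + dg h = mdeg a + syz_dg u)%N ->
        ~ (c = minc a (val u).2 /\ h = (val u).1) ->
        cf D c h (monomial x a *: syz_elt u) <> 0 ->
        (cl h <= (val u).2)%N /\ zero_below (cl h) c].
Proof.
have [k] := ubnP (mdeg a); elim: k a => // k IH a ak.
case: (exponent_min a) => [->|[b [i [ab b0]]]] au.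
  rewrite monomial0 scale1r mdeg0 add0n.
  have [t_std _ t_deg] := svalP (cid syz_tail_exists) u;
    rewrite -/syz_tail in t_std t_deg.
  have xdE : x (val u).2 *: delta A (val u).1 =
      monomial x (minc (mzero n) (val u).2) *: delta A (val u).1.
    by rewrite monomial_minc ?monomial0 ?mulr1 // => j _; rewrite ffunE.
  rewrite /syz_elt xdE; exists 1; split.
  - exact: invertible1.
  - apply: fdegltD; first by apply: fdeglt_term; rewrite mdeg_minc mdeg0.
    by apply: fdegltN => c h /t_deg[]; rewrite ltnS.
  - rewrite cfB cf_term !eqxx /=.
    have [->|/t_std/zero_below_minc[_]] :=
      pselect (cf D (minc (mzero n) (val u).2) (val u).1 (syz_tail u) = 0).
      by rewrite subr0.
    by rewrite leqNgt (valP u).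
  - move=> c h ch nc; rewrite cfB cf_term.
    have -> : (c == minc (mzero n) (val u).2) && (h == (val u).1) = false.
      by apply/negP => /andP[/eqP ? /eqP ?]; apply: nc.
    rewrite sub0r => /eqP; rewrite oppr_eq0 => /eqP nz.
    by have [_ /(_ ch)] := t_deg _ _ nz; split=> //; exact: t_std nz.
have [bu ui] : zero_below (syz_cl u) b /\ (syz_cl u <= i)%N.
  by apply/zero_below_minc; rewrite -ab.
have bi : zero_below i b.
  by move=> l li; have := b0 l li; rewrite ab ffunE; lia.
have [|w [w_inv wdeg wE wstd]] := IH b _ bu; first by move: ak; rewrite ab mdeg_minc.
have ma : mdeg a = (mdeg b).+1 by rewrite ab mdeg_minc.
have -> : monomial x a = x i * monomial x b by rewrite ab monomial_minc.
rewrite -scalerA.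
have xminc c h : (mdeg c + dg h = mdeg b + syz_dg u)%N ->
    cf D (minc c i) h (x i *: (monomial x b *: syz_elt u)) =
    pbw_sigma D i (cf D c h (monomial x b *: syz_elt u)) * lcu D i c.
  by move=> e; apply: (@cf_x_minc _ _ _ _ _ _ _ dg); rewrite e.
exists (pbw_sigma D i w * lcu D i (minc b (val u).2)); split.
- by apply: invertibleM; [exact: invertible_rmorph|exact: lcu_inv].
- by rewrite ma addSn; exact: fdeglt_mul_x.
- by rewrite ab mincC xminc ?wE // mdeg_minc /syz_dg addnS addSn.
(* Top-degree terms of a multiple of [x_i] involve [x_i]; each is the shift of a top-degree term of
   [x^b] times the syzygy, to which induction applies. *)
move=> c h ch nc; have [ci|] := posnP (c i).
  by rewrite (cf_x_0 (dg := dg)) // ch ma addSn.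
move=> /minc_exists[c' cc'].
have ch' : (mdeg c' + dg h = mdeg b + syz_dg u)%N.
  by move: ch; rewrite ma cc' mdeg_minc !addSn => -[].
rewrite cc' xminc // => nz.
have [||cl_h c'h] := wstd c' h ch'.
- by move=> [c'E hE]; apply: nc; rewrite cc' c'E ab mincC.
- by move=> c0; apply: nz; rewrite c0 rmorph0 mul0r.
split=> //; apply/zero_below_minc; split=> //; exact: leq_trans cl_h ui.
Qed.

Lemma fdeglt_syz_val k f : standard syz_cl f -> fdeglt D syz_dg k f ->
  fdeglt D dg k (syz_val f).
Proof.
move=> f_std fk.
apply: (@cf_ind _ _ _ _ _ D _ (fun a u => zero_below (syz_cl u) a /\
  (mdeg a + syz_dg u < k)%N)
  (fun f => fdeglt D dg k (syz_val f))) => [|u v IHu IHv|r a u [au auk]|a u nz].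
- by rewrite linear0; exact: fdeglt0.
- by rewrite linearD; exact: fdegltD.
- rewrite syz_val_term; apply: fdegltZ.
  by have [w [_ + _ _]] := syz_lead au; exact: fdeglt_leq.
- by split; [exact: f_std nz|exact: fk nz].
Qed.

(** No other standard term of at most this degree contributes to the leading term of [x^a e_u]: its
    own leading term is different, its remaining top-degree terms are standard while this one is
    not, and its lower terms have too small a degree. *)
Lemma cf_syz_val (a : Mon) (u : syz_gen) : zero_below (syz_cl u) a ->
  exists w, invertible w /\
    forall f, standard syz_cl f -> fdeglt D syz_dg (mdeg a + syz_dg u).+1 f ->
      cf D (minc a (val u).2) (val u).1 (syz_val f) = cf D a u f * w.
Proof.
move=> au; have [w [w_inv wdeg wE wstd]] := syz_lead au.
exists w; split=> // f f_std fk.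
apply: (@cf_ind _ _ _ _ _ D _
  (fun b v => zero_below (syz_cl v) b /\ (mdeg b + syz_dg v < (mdeg a + syz_dg u).+1)%N)
  (fun f => cf D (minc a (val u).2) (val u).1 (syz_val f) = cf D a u f * w))
  => [|f1 f2 IH1 IH2|r b v [bv bvk]|b v nz].
- by rewrite linear0 !cf0 mul0r.
- by rewrite linearD !cfD IH1 IH2 mulrDl.
- rewrite syz_val_term !cfZ cf_term.
  have [[-> ->]|ne] := pselect (b = a /\ v = u); first by rewrite wE !eqxx mulr1.
  have -> : (a == b) && (u == v) = false.
    by apply/negP => /andP[/eqP ab /eqP uv]; apply: ne.
  rewrite mulr0 mul0r -[RHS](mulr0 r); congr (_ * _).
  have [w' [_ bdeg _ bstd]] := syz_lead bv.
  apply: contrapT => nz.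
  have := bdeg _ _ nz; rewrite ltnS leq_eqVlt => /predU1P[eqd|]; last first.
    by move: bvk; rewrite mdeg_minc /syz_dg; lia.
  have [|cl_u] := bstd _ _ eqd _ nz.
    move=> [cE uE]; have [ab uv] := minc_min_inj au bv cE; apply: ne; split=> //.
    by apply: val_inj; rewrite [LHS]surjective_pairing [RHS]surjective_pairing -uE -uv.
  by move/zero_below_minc => [_]; rewrite leqNgt (valP u).
- by split; [exact: f_std nz|exact: fk nz].
Qed.

(** By [cf_syz_val] each top-degree coefficient of [f], times an invertible element, is a
    coefficient of its image, so the degree bound can be lowered down to 0. *)
Lemma syz_inj f : standard syz_cl f -> syz_val f = 0 -> f = 0.
Proof.
move=> f_std f0; have [k] := fdeglt_exists D syz_dg f.
elim: k => [fk|k IH fk]; first by apply: (@cf_eq0 _ _ _ _ _ D) => a u;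
  apply: contrapT => /fk.
apply: IH => a u nz; have := fk a u nz; rewrite ltnS leq_eqVlt => /predU1P[auk|//].
have [w [w_inv wP]] := cf_syz_val (f_std a u nz); exfalso; apply: nz.
have := wP f f_std; rewrite auk f0 cf0 => /(_ fk)/esym.
exact: invertible_mul0.
Qed.

(** A division algorithm: every non-standard term is the leading term of a standard multiple of a
    syzygy. The outer induction is on a bound for the non-standard terms, the inner one on a list of
    those of top degree. Once none is left, [v] is standard in the kernel, hence 0. *)
Lemma syz_surj k (v : free_mod A G) : p v = 0 ->
  (forall a g, cf D a g v <> 0 -> ~ zero_below (cl g) a -> (mdeg a + dg g < k)%N) ->
  exists f, [/\ standard syz_cl f, fdeglt D syz_dg k f & syz_val f = v].
Proof.
elim: k v => [|k IHk] v v0 vk.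
  exists 0; split; [by move=> a g; rewrite cf0|exact: fdeglt0|].
  rewrite linear0; apply/esym/(pom_inj pom) => // a g nz.
  by apply: contrapT => /(vk a g nz).
have [s vs] := cf_support D v.
have {vs} : forall a g, cf D a g v <> 0 -> ~ zero_below (cl g) a ->
    (mdeg a + dg g = k)%N -> (a, g) \in s by move=> a g /vs.
elim: s v v0 vk => [|[c h] s IHs] v v0 vk vs.
  have [a g nz ns|f [f_std fk fv]] := IHk v v0.
    have := vk a g nz ns; rewrite ltnS leq_eqVlt => /predU1P[|//].
    by move/(vs a g nz ns).
  by exists f; split=> //; exact: fdeglt_leq fk.
have [[nz ns chk]|nch] := pselect [/\ cf D c h v <> 0, ~ zero_below (cl h) c
    & (mdeg c + dg h = k)%N]; last first.
  apply: IHs => // a g nz ns agk; have := vs a g nz ns agk.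
  rewrite inE => /predU1P[[ac gh]|//]; case: nch; split; by rewrite -?ac -?gh.
have [c0|[b [j [cb c0]]]] := exponent_min c.
  by case: ns => i _; rewrite c0 ffunE.
have jh : (j < cl h)%N.
  by rewrite ltnNge; apply/negP => hj; apply: ns; exact: zero_below_leq hj c0.
pose u : syz_gen := exist _ (h, j) jh.
have bu : zero_below (syz_cl u) b.
  by have /zero_below_minc[] : zero_below j (minc b j) by rewrite -cb.
have buk : (mdeg b + syz_dg u)%N = k by rewrite -chk cb mdeg_minc /syz_dg /= addnS addSn.
have [w [[w' [ww' w'w]] wP]] := cf_syz_val bu.
(* Chosen so that the leading coefficient [r * w] of the image of [f1] cancels the coefficient of
   [v] at [(c, h)]. *)
pose r := cf D c h v * w'.
pose f1 := iota r *: (monomial x b *: delta A u).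
have cf1 a u' : cf D a u' f1 = r * ((a == b) && (u' == u))%:R by rewrite cfZ cf_term.
have f1_std : standard syz_cl f1.
  by move=> a u'; rewrite cf1; case: eqP => [->|_]; case: eqP => [->|_] //;
    rewrite mulr0.
have f1k : fdeglt D syz_dg k.+1 f1 by apply/fdegltZ/fdeglt_term; rewrite buk.
have v1k := fdeglt_syz_val f1_std f1k.
have [|a g|a g|f2 [f2_std f2k f2v]] := IHs (v - syz_val f1).
- by rewrite linearB v0 sub0r [p _](val_ker (syz_map f1)) oppr0.
- rewrite cfB => nza nsa; have [v0a|/vk/(_ nsa)//] := pselect (cf D a g v = 0).
  by apply: v1k => e; apply: nza; rewrite v0a e subr0.
- rewrite cfB => nza nsa agk.
  have [[ac gh]|ne] := pselect (a = c /\ g = h).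
    case: nza; have e1 : cf D c h (syz_val f1) = cf D b u f1 * w.
      by rewrite cb; apply: (wP f1 f1_std); rewrite buk.
    by rewrite ac gh e1 cf1 !eqxx mulr1 -mulrA w'w mulr1 subrr.
  have [a0|[b' [j' [ab' a0]]]] := exponent_min a.
    by case: nsa => i _; rewrite a0 ffunE.
  have jg : (j' < cl g)%N.
    by rewrite ltnNge; apply/negP => hj; apply: nsa; exact: zero_below_leq hj a0.
  pose u2 : syz_gen := exist _ (g, j') jg.
  have bu2 : zero_below (syz_cl u2) b'.
    by have /zero_below_minc[] : zero_below j' (minc b' j') by rewrite -ab'.
  have buk2 : (mdeg b' + syz_dg u2)%N = k by rewrite -agk ab' mdeg_minc /syz_dg /= addnS addSn.
  have [w2 [_ wP2]] := cf_syz_val bu2.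
  (* The subtraction creates no new non-standard term of top degree: such a term is the leading term
     of a standard term other than the one in [f1]. *)
  have v1a : cf D a g (syz_val f1) = 0.
    have -> : cf D a g (syz_val f1) = cf D b' u2 f1 * w2.
      by rewrite ab'; apply: (wP2 f1 f1_std); rewrite buk2.
    rewrite cf1.
    have -> : (b' == b) && (u2 == u) = false.
      by apply/negP => /andP[/eqP eb /eqP/(congr1 val)[eg ej]]; apply: ne;
        rewrite ab' cb eb ej.
    by rewrite mulr0 mul0r.
  rewrite v1a subr0 in nza; have := vs a g nza nsa agk.
  by rewrite inE => /predU1P[[ac gh]|//]; case: ne.
exists (f1 + f2); split.
- move=> a g; rewrite cfD; have [e|/f1_std//] := pselect (cf D a g f1 = 0).
  by rewrite e add0r => /f2_std.
- exact: fdegltD.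
- by rewrite linearD f2v addrC subrK.
Qed.

Lemma syz_pommaret : pommaret_basis syz_cl syz_dg syz_map.
Proof.
split.
- move=> m; have [s ms] := cf_support D (val m).
  have [|f [f_std _ fm]] :=
    @syz_surj (\max_(u <- s) (mdeg u.1 + dg u.2)).+1 (val m) (val_ker m).
    by move=> a g /ms ags _; rewrite ltnS (big_rem _ ags) /= leq_maxl.
  by exists f; split=> //; apply: val_inj.
- by move=> f f_std f0; apply: syz_inj => //; rewrite -[LHS]/(val (syz_map f)) f0.
move=> u i iu; pose v := x i *: syz_elt u.
have u0 : zero_below (syz_cl u) (mzero n) by move=> l _; rewrite ffunE.
have udeg : fdeglt D dg (syz_dg u).+1 (syz_elt u).
  have [w [_ + _ _]] := syz_lead u0.
  by rewrite monomial0 scale1r mdeg0 add0n.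
have vdeg : fdeglt D dg (syz_dg u).+2 v by exact: fdeglt_mul_x.
have pu : p (syz_elt u) = 0 by exact: syz_elt_ker.
have pv : p v = 0 by rewrite linearZ pu; exact: scaler0.
have [a g nz _|f [f_std fk fv]] := @syz_surj (syz_dg u).+2 v pv; first exact: vdeg nz.
exists f; split=> //.
  apply: val_inj; rewrite -[LHS]/(syz_val (x i *: delta A u - f)).
  by rewrite linearB linearZ syz_val_delta fv subrr.
(* If a top-degree term of [f] had class above [i], its leading term would survive in [v]; yet the
   exponent of that leading term does not involve [x_i], whereas [v] is a multiple of [x_i]. *)
move=> a q nz; split=> [|aq]; first by rewrite -ltnS; exact: fk nz.
have aq0 := f_std a q nz; have [w [w_inv wP]] := cf_syz_val aq0.
rewrite leqNgt; apply/negP => iq; apply: nz; apply: (invertible_mul0 w_inv).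
rewrite -(wP f f_std) ?aq // fv; apply: (cf_x_0 (dg := dg)).
  by have /zero_below_minc : zero_below (syz_cl q) a /\
    (syz_cl q <= (val q).2)%N by []; exact.
by move: aq; rewrite mdeg_minc /syz_dg addnS addSn => ->.
Qed.

End Syzygy.

(** A syzygy has class less than that of its generator, so the bound drops at each step. At class 0
    every element is standard and [p] is an isomorphism. *)
Lemma pommaret_pdle N (G : choiceType) (cl dg : G -> nat) (M : lmodType A)
    (p : {linear free_mod A G -> M}) :
  pommaret_basis cl dg p -> (forall g, (cl g <= N)%N) -> pdle N M.
Proof.
elim: N G cl dg M p => [|N IH] G cl dg M p pom clN.
  have std f : standard cl f.
    by move=> a g _ i; rewrite (_ : cl g = 0%N) //; apply/eqP; rewrite -leqn0.
  apply: (@pdle_iso _ 0 _ _ p); last exact: free_projective.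
  apply: zero_bij => [f|m]; first exact: (pom_inj pom).
  by have [f [_ fm]] := pom_surj pom m; exists f.
exists (subm (ker p)), (free_mod A G), (subm_incl _), p; split.
- exact: free_projective.
- by apply: ker_se => m; have [f [_ fm]] := pom_surj pom m; exists f.
apply: IH (syz_pommaret pom) _ => u.
by rewrite -ltnS; apply: leq_trans (clN (val u).1); exact: valP u.
Qed.

(** With class [n] no variable is multiplicative, so the standard elements are the [R]-combinations
    of generators. As these have degree 0, the class condition in degree 1 is vacuous. *)
Lemma pommaret_of_free (G : choiceType) (M : lmodType A)
    (psi : {linear free_mod R G -> res iota M}) :
  injective psi -> surjective_map psi ->
  pommaret_basis (fun=> n) (fun=> 0%N) (flift (fun g => psi (delta R g) : M)).
Proof.
move=> psi_inj psi_surj; set p := flift _.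
pose emb : {linear free_mod R G -> res iota (free_mod A G)} :=
  flift (fun g => delta A g : res iota (free_mod A G)).
have emb_delta g : emb (delta R g) = delta A g by exact: flift_delta.
have pemb f : p (emb f) = psi f.
  apply: (@flift_unique _ _ _ (lincomp (res_lin iota p) emb) psi) => g.
  by rewrite -[LHS]/(p (emb (delta R g))) emb_delta flift_delta.
have cf_emb a g f : cf D a g (emb f) <> 0 -> a = mzero n.
  apply: (@free_ind _ _ xpredT (fun f => cf D a g (emb f) <> 0 -> a = mzero n))
      => // [|u v IHu IHv|r h _].
  - by rewrite linear0 cf0.
  - rewrite linearD cfD; have [u0|/IHu//] := pselect (cf D a g (emb u) = 0).
    by rewrite u0 add0r.
  - rewrite linearZ emb_delta -[delta A h]scale1r -(monomial0 x) cfZ cf_term.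
    by case: eqP => // _; rewrite mulr0.
have emb_std f : standard (fun=> n) (emb f).
  by move=> a g /cf_emb -> i _; rewrite ffunE.
have std_emb f : standard (fun=> n) f -> exists f0, f = emb f0.
  move=> f_std; apply: (@cf_ind _ _ _ _ _ D _ (fun a _ => a = mzero n)
      (fun f => exists f0, f = emb f0)) =>
        [|u v [u0 ->] [v0 ->]|r a g ->|a g /f_std a0].
  - by exists 0; rewrite linear0.
  - by exists (u0 + v0); rewrite linearD.
  - by exists (r *: delta R g); rewrite linearZ emb_delta monomial0 scale1r.
  - by apply/ffunP => i; rewrite a0 // ffunE.
split.
- by move=> m; have [f fm] := psi_surj m; exists (emb f); rewrite pemb.
- move=> f /std_emb[f0 ->]; rewrite pemb => f00.
  by rewrite (_ : f0 = 0) ?linear0 //; apply: psi_inj; rewrite f00 linear0.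
move=> g j _; have [f fm] := psi_surj (p (x j *: delta A g)).
exists (emb f); split=> //; first by rewrite linearB pemb fm subrr.
by move=> a h /cf_emb ->; rewrite mdeg0.
Qed.

(** * From projective dimension over R to projective dimension over A *)

Definition res_free_map (G : choiceType) :
    {linear free_mod R (Mon * G)%type -> res iota (free_mod A G)} :=
  flift (fun u : Mon * G => monomial x u.1 *: delta A u.2 : res iota (free_mod A G)).

Lemma res_free_map_delta (G : choiceType) a (g : G) :
  res_free_map G (delta R (a, g)) = monomial x a *: delta A g.
Proof. exact: flift_delta. Qed.

Lemma cf_linear (G : choiceType) a (g : G) : linear (cf D a g :
  res iota (free_mod A G) -> R^o).
Proof. by move=> r f f'; rewrite cfD [r *: f]res_scaleE cfZ. Qed.

Lemma cf_res_free_map (G : choiceType) a (g : G) f :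
  cf D a g (res_free_map G f) = coef (a, g) f.
Proof.
apply: (@flift_unique _ _ _ (lincomp (mklin (@cf_linear G a g)) (res_free_map G))
  (lcoef R (a, g))) => -[b h].
rewrite -[LHS]/(cf D a g (res_free_map G (delta R (b, h)))) res_free_map_delta cf_term.
by rewrite -[RHS]/(coef (a, g) (delta R (b, h))) coef_delta xpair_eqE.
Qed.

Lemma res_free_map_inj G : injective (res_free_map G).
Proof.
by move=> f f' e; apply: fcoefP => -[a g]; rewrite -!cf_res_free_map e.
Qed.

Lemma res_free_map_surj G : surjective_map (res_free_map G).
Proof.
move=> f; apply: (@cf_ind _ _ _ _ _ D _ (fun _ _ => True)
    (fun f => exists f0, res_free_map G f0 = f)) => // [|u v [u0 <-] [v0 <-]|r a g _].
- by exists 0; rewrite linear0.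
- by exists (u0 + v0); rewrite linearD.
- by exists (r *: delta R (a, g)); rewrite linearZ res_free_map_delta.
Qed.

Lemma res_free_projective (G : choiceType) : projective (res iota (free_mod A G)).
Proof.
have [g [fK gK]] := lin_inv (@res_free_map_inj G) (@res_free_map_surj G).
apply: (@pdle_iso _ 0 _ _ (res_free_map G)); last exact: free_projective.
by exists g.
Qed.

(* For the kernel [K] of a free cover [F -> M], the module [M * K] is isomorphic
   to [F] over [R], hence free over [R]. *)
Lemma res_projective_pdle (M : lmodType A) : projective (res iota M) -> pdle n M.
Proof.
move=> projM; pose K := subm (ker (free_cover M)).
have se := se_res iota (ker_se (@free_cover_surj _ M)).
have [f /bij_lin_inv[g g_bij]] := se_split_iso projM se.
have swap_lin : linear (fun u : res iota K * res iota M => (u.2, u.1) :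
  res iota (M * K)%type).
  by [].
pose psi := lincomp (mklin swap_lin) (lincomp g (res_free_map M)).
have psi_inj : injective psi.
  move=> u v e; apply: res_free_map_inj; apply: (bij_inj g_bij).
  by case: e => e1 e2; rewrite [LHS]surjective_pairing [RHS]surjective_pairing;
    congr pair.
have psi_surj : surjective_map psi.
  move=> [m k]; have [g' gK g'K] := g_bij.
  have [u gu] := res_free_map_surj (g' (k, m)).
  exists u; rewrite -[LHS]/((g (res_free_map M u)).2, (g (res_free_map M u)).1).
  by rewrite gu g'K.
apply: (@pdle_summand _ _ M K).
exact: pommaret_pdle (pommaret_of_free psi_inj psi_surj) _.
Qed.

(** Free [A]-covers remain projective over [R], so each syzygy over [A] lowers the bound over [R] by
    one, until the module is projective over [R]. *)
Lemma res_pdle d (M : lmodType A) : pdle d (res iota M) -> pdle (d + n) M.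
Proof.
elim: d M => [|d IH] M pdM; first exact: res_projective_pdle.
have seM := ker_se (@free_cover_surj _ M).
exists (subm (ker (free_cover M))), (free_mod A M), (subm_incl _), (free_cover M).
split=> //; first exact: free_projective.
by apply: IH; exact: pdle_syzygy (@res_free_projective M) (se_res iota seM) pdM.
Qed.

End Pommaret.

Theorem corollary2p6 (R A : pzRingType) (iota : {rmorphism R -> A})
    (n : nat) (x : 'I_n -> A) :
  bijective_skew_PBW iota x ->
  left_regular R -> left_noetherian R ->
  left_regular A.
Proof.
move=> /pbw_data_exists[D] regR noethR M fgM.
have [d pdM] := finitely_generated_res_pdle D noethR regR fgM.
exists (d + n)%N; apply: pdle_proj_dim_le; exact: res_pdle D _ _ pdM.
Qed.
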